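(* Fix $k \in \mathbb{N}_0$. For every $h \ge k+1$ choose a full binary tree $T_h$ which is an extremal tree of Horton–Strahler number $k+1$ and height $h$, label its inner nodes injectively by variables, and let $F_h := D(F_1(T_h))$. Then: (1) $n(F_h) = \Theta(h^{k+1})$, $c(F_h) = \Theta(h^{k+1})$, and $F_h \in \mathrm{UC}_{k+1}$. (2) For every sequence $(F'_h)_{h \ge k+1}$ of clause-sets such that $F'_h$ is equivalent to $F_h$ and $F'_h \in \mathrm{WC}_k$ for all $h$, we have $c(F'_h) = \Omega\!\left(\frac{2^h}{\sqrt{h}}\right)$. Consequently $\mathrm{WC}_k \not\sim \mathrm{UC}_{k+1}$, i.e., there is a sequence $(G_n)_{n\in\mathbb{N}}$ of clause-sets in $\mathrm{UC}_{k+1}$ with $n(G_n)=n$, computable in time $n^{O(1)}$, such that there is no sequence $(G'_n)_{n\in\mathbb{N}}$ in $\mathrm{WC}_k$ with $G'_n$ equivalent to $G_n$ for all $n$ and $\ell(G'_n) = n^{O(1)}$.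
   Context: Literals are variables $v$ and their complements $\overline{v}$. A clause is a finite set of literals not containing both $x$ and $\overline{x}$; a clause-set is a finite set of clauses; $\bot$ is the empty clause and $\top$ the empty clause-set. $\mathrm{var}(C)$, $\mathrm{var}(F)$ are the underlying variables; $n(F) = |\mathrm{var}(F)|$, $c(F) = |F|$, $\ell(F) = \sum_{C \in F}|C|$. A partial assignment $\varphi$ maps a finite set of variables to $\{0,1\}$; $\varphi * F$ is obtained by removing clauses containing a literal set to $1$ and removing literals set to $0$ from the remaining clauses. $F$ is satisfiable iff $\varphi * F = \top$ for some $\varphi$. $F \models C$ iff every $\varphi$ with $\varphi*F=\top$ satisfies $C$. The prime implicates of $F$ are the clauses $C$ with $F \models C$ such that no proper subset of $C$ is implied; two clause-sets are equivalent iff they have the same prime implicates. Resolution: clauses $C,D$ with $C \cap \overline{D} = \{x\}$ have resolvent $(C \cup D)\setminus\{x,\overline{x}\}$. A resolution tree $T: F \vdash C$ is a full binary tree whose nodes are labelled by clauses, leaves by clauses of $F$, every inner node by the resolvent of its children's labels, and the root by $C$. Horton–Strahler number $\mathrm{hts}$ of a full binary tree: $0$ for the one-node tree; otherwise, with subtrees $T_1,T_2$, $\mathrm{hts}(T) = 1+\mathrm{hts}(T_1)$ if $\mathrm{hts}(T_1)=\mathrm{hts}(T_2)$, else $\max(\mathrm{hts}(T_1),\mathrm{hts}(T_2))$. Height is the usual height (one-node tree has height $0$). Hardness $\mathrm{hd}(F)$: if $F$ is unsatisfiable, the minimum of $\mathrm{hts}(T)$ over $T: F \vdash \bot$; $\mathrm{hd}(\top)=0$;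 if $F \ne \top$ is satisfiable, the maximum of $\mathrm{hd}(\varphi*F)$ over partial assignments $\varphi$ with $\varphi*F$ unsatisfiable. $\mathrm{UC}_k := \{F : \mathrm{hd}(F) \le k\}$. W-hardness $\mathrm{whd}(F)$: if $F$ is unsatisfiable, the minimum $k$ such that there is $T: F\vdash \bot$ in which every resolution step has a parent clause of length at most $k$; $\mathrm{whd}(\top)=0$; for satisfiable $F\neq\top$ the maximum of $\mathrm{whd}(\varphi*F)$ over $\varphi$ with $\varphi*F$ unsatisfiable. $\mathrm{WC}_k := \{F : \mathrm{whd}(F)\le k\}$. Tree clause-sets: for a full binary tree $T$ with inner nodes labelled injectively by variables, the edge from an inner node labelled $v$ to its left child is labelled $v$, to its right child $\overline{v}$; for a leaf $w$, $C_w$ is the set of edge labels on the path from the root to $w$, and $F_1(T) := \{C_w : w \text{ leaf of } T\}$. Doping: for a clause-set $F$, each clause $C \in F$ gets a distinct new variable $u_C \notin \mathrm{var}(F)$, and $D(F) := \{C \cup \{u_C\} : C \in F\}$. Extremal trees: a pair $(k,h)\in\mathbb{N}_0^2$ with $h \ge k$ and ($k=0 \Rightarrow h=0$) is allowed; for such a pair a full binary tree $T$ is an extremal tree of Horton–Strahler number $k$ and height $h$ if $\mathrm{hts}(T)=k$, height$(T)=h$, and every full binary tree $T'$ with $\mathrm{hts}(T')\le k$ and height$(T') \le h$ has at most as many nodes as $T$. *)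

(* Defs.v *)
From mathcomp Require Import all_boot finmap.

Set Implicit Arguments.
Unset Strict Implicit.
Unset Printing Implicit Defensive.

Local Open Scope fset_scope.

(* Variables are natural numbers; (v, true) is the literal v and (v, false) its
   complement. *)
Notation literal := (nat * bool)%type.
Notation clause := {fset literal}.
Notation clause_set := {fset {fset literal}}.

Definition compl (l : literal) : literal := (l.1, ~~ l.2).
Definition compls (C : clause) : clause := [fset compl l | l in C].

(* The type [clause] also contains tautological sets of literals; they are
   excluded by [is_clause] and [is_clause_set]. *)
Definition is_clause (C : clause) : Prop :=
  forall l, l \in C -> compl l \notin C.
Definition is_clause_set (F : clause_set) : Prop :=
  forall C, C \in F -> is_clause C.

Definition var (F : clause_set) : {fset nat} :=
  [fset l.1 | C in F, l in C].
Definition nvars (F : clause_set) : nat := #|` var F|.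
Definition nclauses (F : clause_set) : nat := #|` F|.
Definition nlits (F : clause_set) : nat := \sum_(C <- F) #|` C|.

Definition passign := {fmap nat -> bool}.
Definition lit_true (phi : passign) (l : literal) : bool :=
  (phi.[? l.1])%fmap == Some l.2.
Definition lit_false (phi : passign) (l : literal) : bool :=
  (phi.[? l.1])%fmap == Some (~~ l.2).
Definition satisfies (phi : passign) (C : clause) : bool :=
  has (lit_true phi) C.
Definition papply (phi : passign) (F : clause_set) : clause_set :=
  [fset [fset l in (C : clause) | ~~ lit_false phi l]
    | C in F & ~~ satisfies phi C].

Definition satisfiable (F : clause_set) : Prop :=
  exists phi, papply phi F = fset0.

Definition entails (F : clause_set) (C : clause) : Prop :=
  forall phi, papply phi F = fset0 -> satisfies phi C.
Definition prime_implicate (F : clause_set) (C : clause) : Prop :=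
  [/\ is_clause C, entails F C & forall D, D `<` C -> ~ entails F D].
Definition equivalent (F G : clause_set) : Prop :=
  forall C, prime_implicate F C <-> prime_implicate G C.

(* Full binary trees, inner nodes labelled in A and leaves in B. *)
Inductive btree (A B : Type) : Type :=
| Leaf of B
| Node of A & btree A B & btree A B.
Arguments Leaf {A B}.
Arguments Node {A B}.

Fixpoint hts A B (T : btree A B) : nat :=
  match T with
  | Leaf _ => 0
  | Node _ T1 T2 =>
      if hts T1 == hts T2 then (hts T1).+1 else maxn (hts T1) (hts T2)
  end.

Fixpoint height A B (T : btree A B) : nat :=
  match T with
  | Leaf _ => 0
  | Node _ T1 T2 => (maxn (height T1) (height T2)).+1
  end.

Fixpoint nnodes A B (T : btree A B) : nat :=
  match T with
  | Leaf _ => 1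
  | Node _ T1 T2 => (nnodes T1 + nnodes T2).+1
  end.

Fixpoint inner_labels A B (T : btree A B) : seq A :=
  match T with
  | Leaf _ => [::]
  | Node a T1 T2 => a :: inner_labels T1 ++ inner_labels T2
  end.

Definition allowed_pair (k h : nat) : Prop := k <= h /\ (k = 0 -> h = 0).
Definition extremal A B (k h : nat) (T : btree A B) : Prop :=
  [/\ allowed_pair k h, hts T = k, height T = h
    & forall T' : btree unit unit,
        hts T' <= k -> height T' <= h -> nnodes T' <= nnodes T].

Definition resolvent (C D E : clause) : Prop :=
  exists x : literal,
    C `&` compls D = [fset x] /\ E = (C `|` D) `\` [fset x; compl x].

Definition rtree := btree clause clause.
Definition root_label (T : rtree) : clause :=
  match T with Leaf C => C | Node C _ _ => C end.
Fixpoint is_resolution (F : clause_set) (T : rtree) : Prop :=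
  match T with
  | Leaf C => C \in F
  | Node E T1 T2 =>
      [/\ resolvent (root_label T1) (root_label T2) E, is_resolution F T1
        & is_resolution F T2]
  end.
Definition derives (F : clause_set) (T : rtree) (C : clause) : Prop :=
  is_resolution F T /\ root_label T = C.

Fixpoint parent_width_le (k : nat) (T : rtree) : Prop :=
  match T with
  | Leaf _ => True
  | Node _ T1 T2 =>
      [/\ (#|` root_label T1| <= k) || (#|` root_label T2| <= k),
          parent_width_le k T1 & parent_width_le k T2]
  end.

Definition least (P : nat -> Prop) (m : nat) : Prop :=
  P m /\ forall j, P j -> m <= j.
Definition greatest (P : nat -> Prop) (m : nat) : Prop :=
  P m /\ forall j, P j -> j <= m.

(* The common shape of hd and whd, as the graph of a function of F: the least
   value of [cost F] for unsatisfiable F, extended to satisfiable F by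
   maximising over its unsatisfiable instances. *)
Definition hardness (cost : clause_set -> nat -> Prop) (F : clause_set)
    (m : nat) : Prop :=
  [\/ ~ satisfiable F /\ least (cost F) m,
      F = fset0 /\ m = 0
    | [/\ satisfiable F, F <> fset0
        & greatest (fun j => exists phi, ~ satisfiable (papply phi F) /\
                                         least (cost (papply phi F)) j) m]].

Definition hd : clause_set -> nat -> Prop :=
  hardness (fun F m => exists T, derives F T fset0 /\ hts T = m).
Definition whd : clause_set -> nat -> Prop :=
  hardness (fun F m => exists T, derives F T fset0 /\ parent_width_le m T).

Definition UC (k : nat) (F : clause_set) : Prop := exists m, hd F m /\ m <= k.
Definition WC (k : nat) (F : clause_set) : Prop := exists m, whd F m /\ m <= k.

Definition clauses_of (cs : seq (seq literal)) : clause_set :=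
  [fset [fset l in (c : seq literal)] | c in cs].

Fixpoint leaf_paths (T : btree nat unit) : seq (seq literal) :=
  match T with
  | Leaf _ => [:: [::]]
  | Node v T1 T2 =>
      map (cons (v, true)) (leaf_paths T1) ++
      map (cons (v, false)) (leaf_paths T2)
  end.
Definition F1 (T : btree nat unit) : clause_set := clauses_of (leaf_paths T).

Definition doping_vars (F : clause_set) (u : clause -> nat) : Prop :=
  {in F &, injective u} /\ forall C, C \in F -> u C \notin var F.
Definition doping (F : clause_set) (u : clause -> nat) : clause_set :=
  [fset (u C, true) |` C | C in F].

(* n^O(1) *)
Definition poly_bounded (f : nat -> nat) : Prop :=
  exists e N, forall n, N <= n -> f n <= n ^ e.

(* Polynomial time is formalised by structured programs over finitely many
   stacks of bits, every push, pop and test costing one time unit.  A tape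
   amounts to two stacks, so this agrees with multi-tape Turing machines up to
   a polynomial. *)
Inductive prog : Type :=
| Skip
| Push of nat & bool
| Pop of nat
| Seq of prog & prog
| Case of nat & prog & prog & prog  (* top bit 1 / top bit 0 / empty stack *)
| While of nat & prog.              (* while the stack is not empty *)

Definition store := nat -> seq bool.

Inductive exec : prog -> store -> store -> nat -> Prop :=
| ExecSkip s : exec Skip s s 1
| ExecPush r b s : exec (Push r b) s [eta s with r |-> b :: s r] 1
| ExecPop r s : exec (Pop r) s [eta s with r |-> behead (s r)] 1
| ExecSeq p q s s' s'' t t' :
    exec p s s' t -> exec q s' s'' t' -> exec (Seq p q) s s'' (t + t')
| ExecCase r p1 p0 pe s s' t :
    exec (match s r with
          | true :: _ => p1
          | false :: _ => p0
          | [::] => pe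
          end) s s' t ->
    exec (Case r p1 p0 pe) s s' t.+1
| ExecWhileStop r p s : s r = [::] -> exec (While r p) s s 1
| ExecWhileStep r p s s' s'' t t' :
    s r <> [::] -> exec p s s' t -> exec (While r p) s' s'' t' ->
    exec (While r p) s s'' (t + t').+1.

Definition encode_literal (l : literal) : seq bool :=
  nseq l.1 true ++ [:: false; l.2].
Definition encode_clause (c : seq literal) : seq bool :=
  flatten [seq true :: encode_literal l | l <- c] ++ [:: false].
Definition encode (cs : seq (seq literal)) : seq bool :=
  flatten [seq true :: encode_clause c | c <- cs] ++ [:: false].

(* Since time is measured in n itself, the input n is given in unary, on
   stack 0; the output is a listing of G n, also on stack 0. *)
Definition poly_time_computable (G : nat -> clause_set) : Prop :=
  exists (p : prog) (time : nat -> nat), poly_bounded time /\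
    forall n, 0 < n -> exists s t cs,
      [/\ exec p [eta fun=> [::] with 0 |-> nseq n true] s t, t <= time n,
          s 0 = encode cs & G n = clauses_of cs].

(* Main.v *)
Require Import Defs.
From mathcomp Require Import all_boot all_order all_algebra finmap.
From mathcomp Require Import all_classical all_reals all_analysis.
From mathcomp Require Import zify.
Import Order.TTheory GRing.Theory Num.Theory numFieldNormedType.Exports.

(* An assignment satisfies the doped clause-set of a tree [T] iff the doping
   variable of the one leaf whose clause it falsifies is true.  Hence [T], pruned
   by a partial assignment, is a decision tree refuting an unsatisfiable
   instance, and decision trees turn into resolution trees without increasing
   the Horton-Strahler number; this bounds the hardness from above.

   For the lower bound, every nonempty set [S] of leaves gives an implicate
   [pure T S], and every implicate contains some [pure T S'].  Falsifying
   [pure T S] makes an equivalent clause-set of w-hardness at most [k]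
   unsatisfiable, and a refutation of width [k] starts from a clause with at most
   [k] literals; so some [S'] coming from a clause satisfies
   [|pure T S' - pure T S| <= k].  Let N_k(T) be the least number of sets [S']
   serving all [S].  At a node with subtrees [T1], [T2], if [S] meets both, then
   [S'] either misses one of them, which costs one literal (the root variable),
   or the budget [k+1] is split among both; so
   N_(k+1)(T) >= min(N_k(T1), N_k(T2)), and N_0(T) >= 2^height(T).  In an extremal
   tree both subtrees are extremal, which gives 2^(h-k) clauses.

   For the uniform family the trees need not be extremal: a complete binary tree
   of depth [k] with a chain of length linear in [n] at each leaf has
   Horton-Strahler number [k+1] and N_k >= 2^(n / 2^(k+1) - 2), and its doped
   clause-set, padded with further doping variables, is easily listed. *)

Set Implicit Arguments.
Unset Strict Implicit.
Unset Printing Implicit Defensive.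

(** * Partial and total assignments *)

Section Semantics.
Local Open Scope fset_scope.
Local Open Scope nat_scope.

Implicit Types (f : nat -> bool) (phi : passign) (F G : clause_set) (C D : clause).

Definition lit_val f (l : literal) := f l.1 == l.2.

(** Total assignments stand in for partial ones because they can be updated freely; [satisfiableP]
    and [entailsP] translate back. *)
Definition models f F := forall C, C \in F -> has (lit_val f) C.

Definition extends f phi := forall x b, (phi.[? x])%fmap = Some b -> f x = b.

Definition total_ext phi f : nat -> bool :=
  fun x => odflt (f x) (phi.[? x])%fmap.

Lemma total_extP phi f : extends (total_ext phi f) phi.
Proof. by move=> x b; rewrite /total_ext => ->. Qed.

Lemma complK : involutive compl.
Proof. by case=> x b; rewrite /compl /= negbK. Qed.

Lemma in_compls C l : (l \in compls C) = (compl l \in C).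
Proof.
apply/imfsetP/idP => [[l' /= l'C ->]|lC]; first by rewrite complK.
by exists (compl l); rewrite ?complK.
Qed.

Lemma papplyP phi F D :
  reflect (exists C, [/\ C \in F, ~~ satisfies phi C
                       & D = [fset l in C | ~~ lit_false phi l]])
          (D \in papply phi F).
Proof.
rewrite /papply; apply: (iffP (imfsetP _ _ _ _)) => [[C /=]|[C [CF sC ->]]].
  by rewrite inE => /andP[CF sC] ->; exists C.
by exists C => //=; rewrite inE CF.
Qed.

Lemma papply_eq0 phi F :
  papply phi F = fset0 <-> forall C, C \in F -> satisfies phi C.
Proof.
split=> [F0 C CF|sF].
  apply/negPn/negP => nsC.
  have : [fset l in C | ~~ lit_false phi l] \in papply phi F.
    by apply/papplyP; exists C.
  by rewrite F0 inE.
apply/fsetP => D; rewrite inE; apply/negbTE/negP => /papplyP[C [CF nsC _]].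
by rewrite sF in nsC.
Qed.

Lemma extends_lit_true f phi l : extends f phi -> lit_true phi l -> lit_val f l.
Proof. by move=> fphi /eqP/fphi; rewrite /lit_val => ->. Qed.

Lemma extends_lit_false f phi l :
  extends f phi -> lit_false phi l -> ~~ lit_val f l.
Proof. by move=> fphi /eqP/fphi; rewrite /lit_val => ->; case: (l.2). Qed.

Lemma extends_satisfies f phi C :
  extends f phi -> satisfies phi C -> has (lit_val f) C.
Proof.
move=> fphi /hasP[l lC lt]; apply/hasP; exists l => //.
exact: extends_lit_true lt.
Qed.

Definition passign_on (X : {fset nat}) f : passign := [fmap x : X => f (val x)]%fmap.

Lemma passign_onE (X : {fset nat}) f x :
  ((passign_on X f).[? x])%fmap = if x \in X then Some (f x) else None.
Proof.
case: ifP => [xX|/negbT xX]; last by rewrite not_fnd.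
by rewrite (in_fnd xX) ffunE.
Qed.

Lemma in_var F C (l : literal) : C \in F -> l \in C -> l.1 \in var F.
Proof.
by move=> CF lC; apply/imfset2P; exists C => //; exists l.
Qed.

Lemma varP F x : reflect (exists C b, C \in F /\ (x, b) \in C) (x \in var F).
Proof.
rewrite /var; apply: (iffP (imfset2P _ _ _ _ _)) =>
  [[C /= CF [[y b] /= lC ->]]|[C [b [CF lC]]]].
  by exists C, b.
by exists C => //; exists (x, b).
Qed.

Lemma models_satisfiable f F : models f F -> satisfiable F.
Proof.
move=> fF; exists (passign_on (var F) f); apply/papply_eq0 => C CF.
have /hasP[l lC /eqP vl] := fF _ CF; apply/hasP; exists l => //.
by rewrite /lit_true passign_onE (in_var CF lC) vl.
Qed.

Lemma models_papply f phi F : extends f phi -> models f F -> models f (papply phi F).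
Proof.
move=> fphi fF D /papplyP[C [CF _ ->]].
have /hasP[l lC vl] := fF _ CF; apply/hasP; exists l => //.
by rewrite !inE lC /=; apply: contraL vl; apply: extends_lit_false.
Qed.

Lemma unsat_papply phi F f :
  ~ satisfiable (papply phi F) -> extends f phi -> ~ models f F.
Proof. by move=> uns fphi fF; apply/uns/(@models_satisfiable f)/models_papply. Qed.

Lemma satisfiable_papply phi F :
  satisfiable (papply phi F) -> exists f, extends f phi /\ models f F.
Proof.
case=> psi /papply_eq0 sat.
(* [phi] takes precedence over [psi]: a literal that survives [phi] is either true under [phi] or
   left to [psi]. *)
exists (total_ext phi (total_ext psi xpredT)); split; first exact: total_extP.
move=> C CF; have [sC|nsC] := boolP (satisfies phi C).
  by apply: extends_satisfies sC; apply: total_extP.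
have /sat/hasP[l] : [fset l in C | ~~ lit_false phi l] \in papply phi F.
  by apply/papplyP; exists C.
rewrite !inE => /andP[lC nlf] /eqP lt; apply/hasP; exists l => //.
rewrite /lit_val /total_ext lt /=.
case E: (phi.[? l.1])%fmap => [b|] //=.
move: nlf; rewrite /lit_false E; case: (b =P l.2) => [->|] //.
by case: b {E} (l.2) => -[].
Qed.

Lemma satisfiableP F : satisfiable F <-> exists f, models f F.
Proof.
split=> [[phi /papply_eq0 sat]|[f]]; last exact: models_satisfiable.
exists (total_ext phi xpredT) => C /sat; apply: extends_satisfies.
exact: total_extP.
Qed.

Lemma is_clause_papply phi F : is_clause_set F -> is_clause_set (papply phi F).
Proof.
move=> cF D /papplyP[C [CF _ ->]] l; rewrite !inE => /andP[lC _].
by rewrite negb_and (cF _ CF _ lC).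
Qed.

Lemma is_clause_sub C D : is_clause C -> D `<=` C -> is_clause D.
Proof.
move=> cC /fsubsetP DC l /DC/cC; apply: contra; exact: DC.
Qed.

Definition falsify C : nat -> bool := fun x => (x, false) \in C.

Lemma falsifyP C l : is_clause C -> l \in C -> ~~ lit_val (falsify C) l.
Proof.
case: l => x [] cC lC; rewrite /lit_val /falsify /=; last by rewrite lC.
by rewrite eqb_id; have := cC _ lC.
Qed.

Definition falsify_on C : passign := passign_on [fset l.1 | l in C] (falsify C).

Lemma lit_false_on C l : is_clause C -> lit_false (falsify_on C) l = (l \in C).
Proof.
move=> cC; rewrite /lit_false passign_onE; case: ifP => [/imfsetP[l' /= l'C ll']|].
  apply/eqP/idP => [[]|lC].
    have := cC _ l'C; move: l'C ll'; case: l => x b; case: l' => y b' /= + ->.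
    rewrite /falsify /compl /=.
    by case: b b' => -[] /= yC nyC; rewrite ?yC // => ->.
  by congr Some; move: (falsifyP cC lC); rewrite /lit_val; case: (falsify _ _) (l.2) => -[].
move=> /negbT nx; apply/eqP/idP => // lC; case/negP: nx.
by apply/imfsetP; exists l.
Qed.

Lemma entailsP F C : is_clause C ->
  entails F C <-> forall f, models f F -> has (lit_val f) C.
Proof.
move=> cC; split=> [FC f fF|FC phi /papply_eq0 sF].
  pose phi := passign_on (var F `|` [fset l.1 | l in C]) f.
  have fphi : extends f phi by move=> x b; rewrite passign_onE; case: ifP => // _ [].
  apply: (extends_satisfies fphi); apply/FC/papply_eq0 => D DF.
  have /hasP[l lD /eqP vl] := fF _ DF; apply/hasP; exists l => //.
  by rewrite /lit_true passign_onE inE (in_var DF lD) vl.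
apply/negPn/negP => nsC.
(* Off the domain of [phi] the literals of [C] are made false, so a literal of [C] that comes out
   true is already true under [phi]. *)
have /FC/hasP[l lC] : models (total_ext phi (falsify C)) F.
  by move=> D /sF; apply: extends_satisfies; apply: total_extP.
have nl : ~~ lit_true phi l by apply: contra nsC => lt; apply/hasP; exists l.
rewrite /lit_val /total_ext; case E: (phi.[? l.1])%fmap => [b|] /=.
  by apply/negP; move: nl; rewrite /lit_true E.
exact/negP/falsifyP.
Qed.

Lemma prime_sub F C : is_clause C -> entails F C ->
  exists2 D, D `<=` C & prime_implicate F D.
Proof.
have [n] := ubnP #|` C|; elim: n C => // n IH C Cn cC FC.
have [[D [DC FD]]|nD] := pselect (exists D, D `<` C /\ entails F D).
  have [|||E ED pE] := IH D.
  - by rewrite -ltnS (leq_trans _ Cn) // ltnS; apply: fproper_ltn_card.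
  - by apply: is_clause_sub cC _; apply: fproper_sub.
  - by [].
  by exists E => //; apply: fsubset_trans ED _; apply: fproper_sub.
exists C => //; split=> // D DC FD; apply: nD; by exists D.
Qed.

Lemma has_sub f C D : D `<=` C -> has (lit_val f) D -> has (lit_val f) C.
Proof. by move=> /fsubsetP DC /hasP[l /DC lC vl]; apply/hasP; exists l. Qed.

(** Every implicate contains a prime one, and the prime ones are shared. *)
Lemma equivalent_entails F G C : equivalent F G -> is_clause C ->
  entails F C -> entails G C.
Proof.
move=> FG cC FC; have [D DC /FG[cD GD _]] := prime_sub cC FC.
apply/entailsP => // f fG; apply: has_sub DC _.
by move/entailsP: GD; apply.
Qed.

End Semantics.

(** * Resolution and hardness *)

Section Resolution.
Local Open Scope fset_scope.
Local Open Scope nat_scope.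

Implicit Types (F : clause_set) (C p : clause).

(** The combination step of [hts], named so that its monotonicity can be applied to folded goals. *)
Definition hts_node (a b : nat) := if a == b then a.+1 else maxn a b.

Lemma hts_node_mono a b c d : a <= c -> b <= d -> hts_node a b <= hts_node c d.
Proof. by rewrite /hts_node => ac bd; case: eqP; case: eqP => *; lia. Qed.

Lemma hts_node_max a b : maxn a b <= hts_node a b <= (maxn a b).+1.
Proof. by rewrite /hts_node; case: eqP => *; lia. Qed.

(* [T] is a decision tree under which every leaf falsifies a clause of [F], the
   literals of [p] being already false. *)
Fixpoint refutes F p (T : btree nat unit) : Prop :=
  match T with
  | Leaf _ => exists2 C, C \in F & C `<=` p
  | Node v T1 T2 =>
      [/\ forall b, (v, b) \notin p, refutes F ((v, true) |` p) T1
        & refutes F ((v, false) |` p) T2]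
  end.

Lemma is_clause_add p v b : is_clause p -> (forall c, (v, c) \notin p) ->
  is_clause ((v, b) |` p).
Proof.
move=> cp vp l; rewrite !inE => /orP[/eqP->|lp].
  by rewrite /compl /= (negbTE (vp _)) orbF xpair_eqE eqxx; case: b.
rewrite negb_or (cp _ lp) andbT; apply: contraTN lp => /eqP lv.
by rewrite -[l]complK lv /compl /= vp.
Qed.

(** If the clause derived for one branch lacks the branching literal, that branch alone serves;
    otherwise the two clauses are resolved on the branching variable. *)
Lemma refutes_resolution F p T : is_clause p -> refutes F p T ->
  exists R, [/\ is_resolution F R, root_label R `<=` p & hts R <= hts T].
Proof.
elim: T p => [_|v T1 IH1 T2 IH2] p cp /=; first by case=> C CF Cp; exists (Leaf C).
case=> vp /(IH1 _ (is_clause_add cp vp))[R1 [r1 p1 h1]].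
case/(IH2 _ (is_clause_add cp vp)) => [R2 [r2 p2 h2]].
rewrite -/(hts_node _ _).
have /andP[hm _] := hts_node_max (hts T1) (hts T2).
have keep b (R : rtree) : root_label R `<=` (v, b) |` p ->
    (v, b) \notin root_label R -> root_label R `<=` p.
  move=> /fsubsetP s n; apply/fsubsetP => l lR; move: (s _ lR).
  by rewrite !inE => /orP[/eqP E|//]; rewrite -E lR in n.
have [v1|v1] := boolP ((v, true) \in root_label R1); last first.
  by exists R1; split=> //; [exact: keep p1 v1|lia].
have [v2|v2] := boolP ((v, false) \in root_label R2); last first.
  by exists R2; split=> //; [exact: keep p2 v2|lia].
exists (Node ((root_label R1 `|` root_label R2) `\` [fset (v, true); (v, false)]) R1 R2).
split=> /=.
- split=> //; exists (v, true); split=> //.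
  (* A second clash would put a literal and its complement into [p]. *)
  apply/fsetP => l; rewrite !inE in_compls.
  apply/andP/eqP => [[l1 l2]|->]; last by [].
  move/fsubsetP/(_ _ l1): p1; rewrite !inE => /orP[/eqP//|lp].
  move/fsubsetP/(_ _ l2): p2; rewrite !inE => /orP[/eqP E|].
    by rewrite -[l]complK E.
  by move=> nlp; have := cp _ lp; rewrite nlp.
- apply/fsubsetP => l; rewrite !inE negb_or => /andP[/andP[n1 n2]].
  case/orP => [/(fsubsetP p1)|/(fsubsetP p2)]; rewrite !inE.
    by rewrite (negbTE n1).
  by rewrite (negbTE n2).
- exact: hts_node_mono.
Qed.

(** A crude decision tree on all variables, which only serves to show that refutations exist. *)
Fixpoint full_tree (vs : seq nat) : btree nat unit :=
  if vs is v :: vs' then Node v (full_tree vs') (full_tree vs') else Leaf tt.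

Lemma full_tree_refutes F p vs : (forall f, ~ models f F) -> is_clause p ->
  uniq vs -> (forall v b, v \in vs -> (v, b) \notin p) ->
  (forall x, x \in var F -> x \in vs \/ exists b, (x, b) \in p) ->
  refutes F p (full_tree vs).
Proof.
move=> uns; elim: vs p => [|v vs IH] p cp /= uv dp cov.
  case: (pselect (exists2 C, C \in F & C `<=` p)) => // nC.
  (* Were no clause contained in [p], then [falsify p] would be a model: a literal outside [p] has
     its variable in [p] with the opposite sign, hence is true. *)
  case: (uns (falsify p)) => C CF; apply/hasP.
  have [Cp|] := boolP (C `<=` p); first by case: nC; exists C.
  case/fsubsetPn => -[x b] lC lp; exists (x, b) => //.
  have [|//|[c xc]] := cov x; first exact: in_var CF lC.
  have /eqP cb : c != b by apply: contraNneq lp => <-.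
  have : ~~ lit_val (falsify p) (x, c) by exact: falsifyP.
  by rewrite /lit_val /=; case: (falsify _ _) c b cb {lC lp xc} => -[] [].
case/andP: uv => nv uv; split; first by move=> b; apply: dp; rewrite mem_head.
all: apply: IH => //; first by apply: is_clause_add => // c; apply: dp; rewrite mem_head.
1,3: move=> w b wv; rewrite !inE negb_or dp ?inE ?wv ?orbT // andbT;
  by rewrite xpair_eqE negb_and; apply/orP; left; apply: contraNneq nv => <-.
all: move=> x /cov[|[b xb]]; last by right; exists b; rewrite !inE xb orbT.
all: rewrite inE => /orP[/eqP->|]; last by left.
1: by right; exists true; rewrite !inE eqxx.
by right; exists false; rewrite !inE eqxx.
Qed.

(** Provides the refutations without which the minimum defining [whd] of an unsatisfiable instance
    would not exist. *)
Lemma resolution_complete F : is_clause_set F -> ~ satisfiable F ->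
  exists R, derives F R fset0.
Proof.
move=> cF uns; have c0 : is_clause fset0 by move=> l; rewrite inE.
have [|R [rR + _]] := @refutes_resolution F fset0 (full_tree (var F)) c0.
  apply: full_tree_refutes => // [f fF|x xF]; last by left.
  by apply: uns; apply: models_satisfiable fF.
by rewrite fsubset0 => /eqP R0; exists R.
Qed.

Lemma least_exists (P : nat -> Prop) : (exists m, P m) -> exists m, least P m.
Proof.
move=> [m]; have [n] := ubnP m; elim: n m => // n IH m mn Pm.
have [[j [Pj jm]]|nj] := pselect (exists j, P j /\ j < m).
  by apply: (IH j) => //; lia.
by exists m; split=> // j Pj; rewrite leqNgt; apply/negP => jm; apply: nj; exists j.
Qed.

Lemma greatest_exists (P : nat -> Prop) b :
  (exists m, P m) -> (forall m, P m -> m <= b) -> exists m, greatest P m.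
Proof.
move=> [m]; have [n] := ubnP (b - m); elim: n m => // n IH m mn Pm Pb.
have [[j [Pj jm]]|nj] := pselect (exists j, P j /\ m < j).
  by apply: (IH j) => //; have := Pb _ Pj; lia.
by exists m; split=> // j Pj; rewrite leqNgt; apply/negP => jm; apply: nj; exists j.
Qed.

Lemma parent_width_le_mono k m R : k <= m -> parent_width_le k R -> parent_width_le m R.
Proof.
move=> km; elim: R => [//|C R1 IH1 R2 IH2] /= [/orP w /IH1 ? /IH2 ?]; split=> //.
by apply/orP; case: w => w; [left|right]; lia.
Qed.

Lemma parent_width_le_exists R : exists m, parent_width_le m R.
Proof.
elim: R => [C|C R1 [m1 IH1] R2 [m2 IH2]] /=; first by exists 0.
exists (maxn #|` root_label R1| (maxn m1 m2)); split; first by rewrite leq_maxl.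
  by apply: parent_width_le_mono IH1; lia.
by apply: parent_width_le_mono IH2; lia.
Qed.

(** From a short root one can always pass to a short parent, and this walk ends in a short leaf. *)
Lemma narrow_leaf F k R : is_resolution F R -> parent_width_le k R ->
  #|` root_label R| <= k -> exists2 C, C \in F & #|` C| <= k.
Proof.
elim: R => [C|C R1 IH1 R2 IH2] /=; first by exists C.
by case=> _ r1 r2 [/orP[w|w] w1 w2] _; [apply: IH1|apply: IH2].
Qed.

(* Satisfiability of [F] is assumed because [whd] of an unsatisfiable clause-set
   says nothing about its instances. *)
Lemma WC_narrow F k phi : is_clause_set F -> satisfiable F -> WC k F ->
  ~ satisfiable (papply phi F) -> exists2 C, C \in papply phi F & #|` C| <= k.
Proof.
move=> cF sF [m [hm mk]] uns.
case: hm => [[nsF _] //|[F0 _]|[_ _ [_ mmax]]].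
  by case: uns; exists phi; apply/papply_eq0 => C /papplyP[D []]; rewrite F0.
have [R [rR R0]] := resolution_complete (is_clause_papply cF) uns.
have [w wR] := parent_width_le_exists R.
have [|j jl] := @least_exists
    (fun m => exists T, derives (papply phi F) T fset0 /\ parent_width_le m T).
  by exists w, R.
have jm : j <= m by apply: mmax; exists phi; split.
have [[R' [[rR' R'0] wR']] _] := jl.
apply: narrow_leaf rR' _ _; first by apply: parent_width_le_mono wR'; lia.
by rewrite R'0 cardfs0.
Qed.

(** Falsifying the non-tautological clause gives an unsatisfiable instance, so the maximum defining
    [hd] ranges over a nonempty set; the decision trees bound it. *)
Lemma UC_intro F k : satisfiable F -> (exists2 C, C \in F & is_clause C) ->
  (forall phi, ~ satisfiable (papply phi F) ->
     exists T, refutes (papply phi F) fset0 T /\ hts T <= k) ->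
  UC k F.
Proof.
move=> sF [C0 C0F cC0] ref.
pose cost phi := fun m => exists T, derives (papply phi F) T fset0 /\ hts T = m.
have bnd phi : ~ satisfiable (papply phi F) -> exists2 j, cost phi j & j <= k.
  move=> /ref[T [rT hT]].
  have [//|R [rR + hR]] := refutes_resolution _ rT.
  rewrite fsubset0 => /eqP R0.
  by exists (hts R); [exists R|lia].
have [m [[phi [uns lm]] mmax]] : exists m, greatest (fun j => exists phi,
    ~ satisfiable (papply phi F) /\ least (cost phi) j) m.
  apply: (@greatest_exists _ k); last first.
    by move=> m [phi [/bnd[j cj jk] [_ /(_ _ cj) mj]]]; lia.
  have uns : ~ satisfiable (papply (falsify_on C0) F).
    case/satisfiable_papply => f [fC fF]; have /hasP[l lC vl] := fF _ C0F.
    have : lit_false (falsify_on C0) l by rewrite lit_false_on.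
    by move/(extends_lit_false fC); rewrite vl.
  have [j cj _] := bnd _ uns; have [|m lm] := @least_exists (cost (falsify_on C0)).
    by exists j.
  by exists m, (falsify_on C0).
exists m; split.
  constructor 3; split=> //.
  - by move=> F0; move: C0F; rewrite F0 in_fset0.
  - by split=> //; exists phi.
by have [j cj jk] := bnd _ uns; have [_ /(_ _ cj)] := lm; lia.
Qed.

End Resolution.

(** * Doped trees *)

Section DopedTrees.
Local Open Scope fset_scope.
Local Open Scope nat_scope.

Implicit Types (f : nat -> bool) (phi : passign) (F : clause_set) (C : clause).
Implicit Types (T : btree nat (seq nat)) (P : seq literal) (S : {fset nat}).

Definition pos (us : seq nat) : seq literal := [seq (u, true) | u <- us].

(* The leaf labels are the doping variables. *)
Fixpoint gen T P : seq (seq literal) :=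
  match T with
  | Leaf us => [:: pos us ++ P]
  | Node v T1 T2 => gen T2 ((v, false) :: P) ++ gen T1 ((v, true) :: P)
  end.

Definition doped T : clause_set := clauses_of (gen T [::]).

Fixpoint allvars T : seq nat :=
  match T with
  | Leaf us => us
  | Node v T1 T2 => v :: allvars T1 ++ allvars T2
  end.

Fixpoint leaves_doped T : bool :=
  match T with
  | Leaf us => us != [::]
  | Node _ T1 T2 => leaves_doped T1 && leaves_doped T2
  end.

Definition good T := uniq (allvars T) && leaves_doped T.

(** A true [v] satisfies all clauses from [T1], whose paths carry the literal [v]; what remains is
    decided in [T2]. *)
Fixpoint eval T f : bool :=
  match T with
  | Leaf us => has f us
  | Node v T1 T2 => if f v then eval T2 f else eval T1 f
  end.

Lemma good_node v T1 T2 : good (Node v T1 T2) ->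
  [/\ good T1, good T2, v \notin allvars T1, v \notin allvars T2
    & forall x, x \in allvars T1 -> x \notin allvars T2].
Proof.
rewrite /good /= mem_cat negb_or cat_uniq.
case/andP => /and4P[/andP[v1 v2] u1 /hasPn d u2] /andP[l1 l2].
by rewrite u1 u2 l1 l2; split=> // x x1; apply: contraL x1; apply: d.
Qed.

Lemma clauses_ofP (cs : seq (seq literal)) C :
  reflect (exists2 c, c \in cs & C = [fset l in c]) (C \in clauses_of cs).
Proof.
by rewrite /clauses_of; apply: (iffP (imfsetP _ _ _ _)) => -[c /= ? ->]; exists c.
Qed.

Lemma in_clause (c : seq literal) l : (l \in [fset x in c]) = (l \in c).
Proof. by rewrite inE. Qed.

Lemma in_reduct (c : seq literal) phi l :
  (l \in [fset x in c | ~~ lit_false phi x]) = (l \in c) && ~~ lit_false phi l.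
Proof. by rewrite !inE. Qed.

Lemma in_freduct C phi l :
  (l \in [fset x in C | ~~ lit_false phi x]) = (l \in C) && ~~ lit_false phi l.
Proof. by rewrite !inE. Qed.

Lemma has_fset f (c : seq literal) : has (lit_val f) [fset l in c] = has (lit_val f) c.
Proof. by apply: eq_has_r => l; rewrite inE. Qed.

Lemma has_pos f us : has (lit_val f) (pos us) = has f us.
Proof. by rewrite has_map; apply: eq_has => x; rewrite /= /lit_val eqb_id. Qed.

Lemma all_gen f T P :
  all (has (lit_val f)) (gen T P) = eval T f || has (lit_val f) P.
Proof.
elim: T P => [us|v T1 IH1 T2 IH2] P /=; first by rewrite andbT has_cat has_pos.
rewrite all_cat IH1 IH2 /= /lit_val /=.
by case: (f v) (eval T1 f) (eval T2 f) (has _ _) => -[] [] [].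
Qed.

Lemma models_doped f T : models f (doped T) <-> eval T f.
Proof.
have -> : eval T f = all (has (lit_val f)) (gen T [::]) by rewrite all_gen orbF.
split=> [fT|/allP fT C /clauses_ofP[c cT ->]]; last by rewrite has_fset fT.
by apply/allP => c cT; rewrite -has_fset; apply/fT/clauses_ofP; exists c.
Qed.

Lemma eq_eval T f g : {in allvars T, f =1 g} -> eval T f = eval T g.
Proof.
elim: T => [us|v T1 IH1 T2 IH2] /= fg; first exact: eq_in_has.
rewrite fg ?mem_head // IH1 ?IH2 // => x xT; apply: fg;
  by rewrite inE mem_cat xT !orbT.
Qed.

Lemma eval_true T : leaves_doped T -> eval T xpredT.
Proof. by elim: T => [[]|v T1 IH1 T2 IH2 /= /andP[_ /IH2]]. Qed.

Definition fresh T P := forall v b, v \in allvars T -> (v, b) \notin P.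

Lemma uniq_node v T1 T2 : uniq (allvars (Node v T1 T2)) ->
  [/\ v \notin allvars T1, v \notin allvars T2, uniq (allvars T1) & uniq (allvars T2)].
Proof. by rewrite /= mem_cat negb_or cat_uniq => /and4P[/andP[-> ->] -> _ ->]. Qed.

Lemma fresh_node v T1 T2 P : uniq (allvars (Node v T1 T2)) -> fresh (Node v T1 T2) P ->
  forall b, fresh T1 ((v, b) :: P) /\ fresh T2 ((v, b) :: P).
Proof.
move=> /uniq_node[v1 v2 _ _] dT b.
have dPv x c : x \in allvars T1 ++ allvars T2 -> (x, c) \notin (v, b) :: P.
  move=> xT; rewrite inE negb_or dT /= ?inE ?xT ?orbT // andbT xpair_eqE negb_and.
  by apply/orP; left; apply: contraTneq xT => ->; rewrite mem_cat negb_or v1.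
by split=> x c xT; apply: dPv; rewrite mem_cat xT ?orbT.
Qed.

Lemma compl_cons v b P : (forall c, (v, c) \notin P) ->
  {in P, forall l, compl l \notin P} ->
  {in (v, b) :: P, forall l, compl l \notin (v, b) :: P}.
Proof.
move=> vP cP l; rewrite !inE => /orP[/eqP->|lP]; rewrite negb_or.
  by rewrite /compl vP xpair_eqE eqxx /=; case: b.
rewrite cP // andbT; apply: contraTN lP => /eqP/(congr1 compl).
by rewrite complK => ->; apply: vP.
Qed.

Fixpoint prune phi T : btree nat unit :=
  match T with
  | Leaf _ => Leaf tt
  | Node v T1 T2 =>
      match (phi.[? v])%fmap with
      | Some true => prune phi T2
      | Some false => prune phi T1
      | None => Node v (prune phi T1) (prune phi T2)
      end
  end.

Lemma hts_prune phi T : hts (prune phi T) <= hts T.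
Proof.
elim: T => [//|v T1 IH1 T2 IH2] /=; rewrite -/(hts_node (hts T1) (hts T2)).
have /andP[] := hts_node_max (hts T1) (hts T2).
case: (phi.[? v])%fmap => [[]|] /=; try lia.
by move=> _ _; apply: hts_node_mono.
Qed.

(** At a leaf that survives pruning, [phi] makes all doping variables false. What is left of the
    leaf clause are path literals, and these the decision tree has made false. *)
Lemma prune_refutes phi F T P :
  (forall c, c \in gen T P -> [fset l in c] \in F) -> uniq (allvars T) ->
  fresh T P ->
  (forall l, l \in P -> ~~ lit_true phi l) ->
  (forall f, extends f phi -> ~~ eval T f) ->
  refutes (papply phi F) [fset l in P | ~~ lit_false phi l] (prune phi T).
Proof.
elim: T P => [us|v T1 IH1 T2 IH2] P /= TF uT dT nP nT.
  have us_false u : u \in us -> (phi.[? u])%fmap = Some false.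
    (* Were some [u] not already false, extending [phi] by true would satisfy the leaf. *)
    move=> uus; have /hasPn/(_ _ uus) := nT _ (@total_extP phi xpredT).
    by rewrite /total_ext; case: (phi.[? u])%fmap => [[]|].
  exists [fset l in [fset l in pos us ++ P] | ~~ lit_false phi l].
    apply/papplyP; exists [fset l in pos us ++ P]; split=> //.
      by apply: TF; rewrite mem_head.
    apply/hasPn => l; rewrite in_clause mem_cat => /orP[/mapP[u /us_false uf ->]|/nP//].
    by rewrite /lit_true uf.
  apply/fsubsetP => l; rewrite in_reduct in_freduct in_clause mem_cat.
  move=> /andP[/orP[/mapP[u /us_false uf ->]|-> //]].
  by rewrite /lit_false uf.
have [v1 v2 u1 u2] := uniq_node uT; have fT b := fresh_node uT dT b.
have F1 c : c \in gen T1 ((v, true) :: P) -> [fset l in c] \in F.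
  by move=> cT; apply: TF; rewrite mem_cat cT orbT.
have F2 c : c \in gen T2 ((v, false) :: P) -> [fset l in c] \in F.
  by move=> cT; apply: TF; rewrite mem_cat cT.
case E: (phi.[? v])%fmap => [[]|].
(* [phi] fixes [v] and removes its literal, so the path seen by the decision tree stays the same. *)
- have -> : [fset l in P | ~~ lit_false phi l] =
            [fset l in (v, false) :: P | ~~ lit_false phi l].
    by apply/fsetP => l; rewrite !in_reduct inE; case: eqP => // ->;
      rewrite /lit_false E !andbF.
  apply: IH2 => // [|l|f fphi]; first by case: (fT false).
    by rewrite inE => /orP[/eqP->|/nP//]; rewrite /lit_true E.
  by have := nT _ fphi; rewrite (fphi _ _ E).
- have -> : [fset l in P | ~~ lit_false phi l] =
            [fset l in (v, true) :: P | ~~ lit_false phi l].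
    by apply/fsetP => l; rewrite !in_reduct inE; case: eqP => // ->;
      rewrite /lit_false E !andbF.
  apply: IH1 => // [|l|f fphi]; first by case: (fT true).
    by rewrite inE => /orP[/eqP->|/nP//]; rewrite /lit_true E.
  by have := nT _ fphi; rewrite (fphi _ _ E).
(* [v] is free, so an extension of [phi] can be sent into either branch by changing it at [v], which
   does not occur in the subtrees. *)
pose upd f b x := if x == v then b else f x : bool.
have updP f b : extends f phi -> extends (upd f b) phi.
  by move=> fphi x c; rewrite /upd; case: eqP => [->|_]; [rewrite E|apply: fphi].
have add b : (v, b) |` [fset l in P | ~~ lit_false phi l] =
             [fset l in (v, b) :: P | ~~ lit_false phi l].
  by apply/fsetP => l; rewrite in_fset1U !in_reduct inE; case: eqP => // ->;
    rewrite /lit_false E.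
have nPv b l : l \in (v, b) :: P -> ~~ lit_true phi l.
  by rewrite inE => /orP[/eqP->|/nP//]; rewrite /lit_true E.
split=> /=.
- by move=> b; rewrite in_reduct negb_and dT // mem_head.
- rewrite add; apply: IH1 => // [|l|f fphi]; [by case: (fT true)|exact: nPv|].
  have := nT _ (updP f false fphi); rewrite {1}/upd eqxx.
  rewrite (@eq_eval _ _ f) // => x xT; rewrite /upd.
  by case: eqP => // xv; rewrite -xv xT in v1.
- rewrite add; apply: IH2 => // [|l|f fphi]; [by case: (fT false)|exact: nPv|].
  have := nT _ (updP f true fphi); rewrite {1}/upd eqxx.
  rewrite (@eq_eval _ _ f) // => x xT; rewrite /upd.
  by case: eqP => // xv; rewrite -xv xT in v2.
Qed.

Lemma doped_satisfiable T : leaves_doped T -> satisfiable (doped T).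
Proof. by move=> lT; apply: (@models_satisfiable xpredT); apply/models_doped/eval_true. Qed.

Lemma gen_clause T P c : uniq (allvars T) -> fresh T P ->
  {in P, forall l, compl l \notin P} ->
  c \in gen T P -> {in c, forall l, compl l \notin c}.
Proof.
elim: T P => [us|v T1 IH1 T2 IH2] P uT dT cP /=.
  rewrite inE => /eqP-> l; rewrite !mem_cat => /orP[/mapP[u uu ->]|lP].
    by rewrite negb_or dT // andbT; apply/mapP => -[u' _]; rewrite /compl.
  rewrite negb_or (cP _ lP) andbT; apply/mapP => -[u uu /(congr1 compl)].
  by rewrite complK => lE; move: lP; rewrite lE; apply/negP/dT.
have [v1 v2 u1 u2] := uniq_node uT; have fT b := fresh_node uT dT b.
have cPv b : {in (v, b) :: P, forall l, compl l \notin (v, b) :: P}.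
  by apply: compl_cons => // c'; apply: dT; rewrite mem_head.
by rewrite mem_cat => /orP[]; [apply: IH2|apply: IH1] => //;
  [case: (fT false)|case: (fT true)].
Qed.

Lemma gen_prefix T P c : c \in gen T P -> {subset P <= c}.
Proof.
elim: T P => [us|v T1 IH1 T2 IH2] P /=.
  by rewrite inE => /eqP-> l lP; rewrite mem_cat lP orbT.
by rewrite mem_cat => /orP[/IH2|/IH1] sub l lP; apply: sub; rewrite inE lP orbT.
Qed.

Lemma doped_clause_set T : good T -> is_clause_set (doped T).
Proof.
case/andP => uT _ C /clauses_ofP[c cT ->] l; rewrite !in_clause.
exact: (gen_clause uT _ _ cT).
Qed.

Lemma gen_neq0 T P : gen T P != [::].
Proof.
elim: T P => [//|v T1 IH1 T2 _] P /=; rewrite -size_eq0 size_cat addn_eq0.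
by rewrite negb_and !size_eq0 IH1 orbT.
Qed.

Lemma doped_UC T k : good T -> hts T <= k -> UC k (doped T).
Proof.
move=> gT hT; have /andP[uT lT] := gT; apply: UC_intro.
- exact: doped_satisfiable.
- have := gen_neq0 T [::]; case E: gen => [//|c cs] _.
  have cD : [fset l in c] \in doped T.
    by apply/clauses_ofP; exists c; rewrite // E mem_head.
  by exists [fset l in c] => //; apply: doped_clause_set cD.
move=> phi uns; exists (prune phi T); split; last exact: leq_trans (hts_prune _ _) hT.
have -> : fset0 = [fset l in [::] | ~~ lit_false phi l].
  by apply/fsetP => l; rewrite in_reduct !inE.
apply: prune_refutes => // [c cT|f fphi].
  by apply/clauses_ofP; exists c.
apply/negP => fT; apply: (unsat_papply uns fphi); exact/models_doped.
Qed.

End DopedTrees.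

(** * The lower bound *)

Section LowerBound.
Local Open Scope fset_scope.
Local Open Scope nat_scope.

Implicit Types (f : nat -> bool) (phi : passign) (F : clause_set) (C : clause).
Implicit Types (T : btree nat (seq nat)) (S : {fset nat}).

(* Each leaf is represented by the first of its doping variables, so that a set
   of variables describes a set of leaves. *)
Fixpoint prims T : seq nat :=
  match T with
  | Leaf us => [:: head 0 us]
  | Node _ T1 T2 => prims T1 ++ prims T2
  end.

Definition act T S := has (fun u => u \in S) (prims T).

(* For a nonempty set [S] of leaves this lists the prime implicate of [doped T]
   belonging to [S]: the doping variables and the pure literals of the clauses
   of [S]. *)
Fixpoint pure T S : seq literal :=
  match T with
  | Leaf us => if head 0 us \in S then pos us else [::]
  | Node v T1 T2 =>
      (if act T1 S then if act T2 S then [::] else [:: (v, true)]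
       else if act T2 S then [:: (v, false)] else [::])
      ++ pure T1 S ++ pure T2 S
  end.

Definition cost T S' S := count (fun l => l \notin pure T S) (pure T S').

(* [S'] is a trigger for [S]: once [pure T S] is falsified, [pure T S'] is
   neither satisfied nor has more than [k] literals left. *)
Definition covers k T S' S :=
  [&& act T S', ~~ has (fun l => compl l \in pure T S) (pure T S')
    & cost T S' S <= k].

(** This says N_k(T) >= m, without naming the minimum. *)
Definition needs k T m := forall L : seq {fset nat}, size L < m ->
  exists S, [/\ act T S, {subset S <= prims T}
              & forall S', S' \in L -> ~~ covers k T S' S].

Lemma act_node v T1 T2 S : act (Node v T1 T2) S = act T1 S || act T2 S.
Proof. exact: has_cat. Qed.

Lemma pure_inactive T S : ~~ act T S -> pure T S = [::].
Proof.
elim: T => [us|v T1 IH1 T2 IH2] /=; first by rewrite /act /= orbF => /negbTE->.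
rewrite act_node negb_or => /andP[a1 a2].
by rewrite (negbTE a1) (negbTE a2) IH1 // IH2.
Qed.

Lemma pure_neq0 T S : leaves_doped T -> act T S -> pure T S != [::].
Proof.
elim: T => [us|v T1 IH1 T2 IH2] /=; first by rewrite /act /= orbF => + ->; case: us.
move=> /andP[/IH1 {}IH1 /IH2 {}IH2]; rewrite act_node -!size_eq0 !size_cat !addn_eq0 !size_eq0.
by case/orP => [/IH1|/IH2] /negbTE->; rewrite ?andbF.
Qed.

Lemma map_fst_pos us : [seq l.1 | l <- pos us] = us.
Proof. by rewrite -map_comp -[RHS]map_id; apply: eq_map. Qed.

(** When the variables of the tree are distinct, this makes [pure T S] duplicate-free and
    non-tautological. *)
Lemma pure_vars T S : subseq [seq l.1 | l <- pure T S] (allvars T).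
Proof.
elim: T => [us|v T1 IH1 T2 IH2] /=.
  by case: ifP => _; rewrite ?sub0seq // map_fst_pos.
rewrite !map_cat; apply: (@cat_subseq _ _ _ [:: v]); last exact: cat_subseq.
by case: (act T1 S) (act T2 S) => -[] /=; rewrite ?eqxx.
Qed.

Lemma pure_var T S l : l \in pure T S -> l.1 \in allvars T.
Proof. by move=> lT; apply: (mem_subseq (pure_vars T S)); apply: map_f. Qed.

Lemma pure_uniq T S : uniq (allvars T) -> uniq (pure T S).
Proof. by move=> uT; apply: (map_uniq (subseq_uniq (pure_vars T S) uT)). Qed.

Lemma pure_compl T S l : uniq (allvars T) -> l \in pure T S -> compl l \notin pure T S.
Proof.
move=> uT; have := subseq_uniq (pure_vars T S) uT.
elim: (pure T S) => // l' s IH /= /andP[l's us].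
rewrite !inE negb_or => /orP[/eqP->|ls]; last first.
  rewrite (IH us ls) andbT; apply: contraNneq l's => <-.
  by apply/mapP; exists l.
apply/andP; split; first by case: l' {IH l's} => x []; rewrite xpair_eqE andbF.
by apply: contra l's => l's; apply/mapP; exists (compl l').
Qed.

(** Follow the branch chosen by [f]: as soon as [S] has no leaf in the chosen subtree, the root
    literal of the other side is pure and true. *)
Lemma pure_sat T S f : eval T f -> act T S -> has (lit_val f) (pure T S).
Proof.
elim: T => [us|v T1 IH1 T2 IH2] /=.
  by rewrite /act /= orbF => fT ->; rewrite has_pos.
rewrite act_node !has_cat; case E: (f v) => fT.
  have [/(IH2 fT)->|a2] := boolP (act T2 S); first by rewrite !orbT.
  by rewrite orbF => ->; rewrite /= /lit_val /= E.
have [/(IH1 fT)->|a1] := boolP (act T1 S); first by rewrite !orbT.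
by move=> /= ->; rewrite /= /lit_val /= E.
Qed.

Lemma act_ext T S S' : {in prims T, S =i S'} -> act T S = act T S'.
Proof. by move=> SS; apply: eq_in_has => x /SS. Qed.

Lemma pure_ext T S S' : {in prims T, S =i S'} -> pure T S = pure T S'.
Proof.
elim: T => [us|v T1 IH1 T2 IH2] /= SS; first by rewrite SS ?mem_head.
have S1 : {in prims T1, S =i S'} by move=> x xT; apply: SS; rewrite mem_cat xT.
have S2 : {in prims T2, S =i S'} by move=> x xT; apply: SS; rewrite mem_cat xT orbT.
by rewrite (act_ext S1) (act_ext S2) IH1 // IH2.
Qed.

Lemma covers_ext k T S' S S0 : {in prims T, S =i S0} -> covers k T S' S = covers k T S' S0.
Proof. by move=> SS; rewrite /covers /cost (pure_ext SS). Qed.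

Lemma prims_allvars T : leaves_doped T -> {subset prims T <= allvars T}.
Proof.
elim: T => [us|v T1 IH1 T2 IH2] /=.
  by case: us => [//|u us] _ x; rewrite !inE => ->.
case/andP => /IH1{}IH1 /IH2{}IH2 x.
by rewrite mem_cat inE mem_cat => /orP[/IH1|/IH2] ->; rewrite ?orbT.
Qed.

Section Node.
Variables (v : nat) (T1 T2 : btree nat (seq nat)).
Hypothesis gT : good (Node v T1 T2).

Lemma disjoint_prims x : x \in prims T1 -> x \notin prims T2.
Proof.
have [/andP[_ l1] /andP[_ l2] _ _ d] := good_node gT.
by move/(prims_allvars l1)/d; apply: contra; apply: prims_allvars.
Qed.

Section Glue.
Variables S1 S2 : {fset nat}.
Hypotheses (S1T : {subset S1 <= prims T1}) (S2T : {subset S2 <= prims T2}).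

(** Sets of leaves of the two subtrees are combined by union and recovered by restriction, as the
    leaves are disjoint. *)
Lemma glue1 : {in prims T1, S1 `|` S2 =i S1}.
Proof.
move=> x xT; rewrite inE orbC; case: (boolP (x \in S2)) => // /S2T.
by rewrite (negbTE (disjoint_prims xT)).
Qed.

Lemma glue2 : {in prims T2, S1 `|` S2 =i S2}.
Proof.
move=> x xT; rewrite inE; case: (boolP (x \in S1)) => // /S1T/disjoint_prims.
by rewrite xT.
Qed.

Lemma glue_sub : {subset S1 `|` S2 <= prims (Node v T1 T2)}.
Proof. by move=> x; rewrite inE mem_cat => /orP[/S1T|/S2T] ->; rewrite ?orbT. Qed.

End Glue.

Lemma pure_node1 S l : l.1 \in allvars T1 -> (l \in pure (Node v T1 T2) S) = (l \in pure T1 S).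
Proof.
have [_ _ v1 _ d] := good_node gT.
move=> l1; rewrite /= !mem_cat.
have -> : (l \in pure T2 S) = false.
  by apply: contraTF l1 => /pure_var l2; apply: contraL l2; apply: d.
have lv b : (l == (v, b)) = false by apply: contraNF v1 => /eqP lv; rewrite lv in l1.
by case: (act T1 S) (act T2 S) => -[]; rewrite ?inE ?lv ?orbF.
Qed.

Lemma pure_node2 S l : l.1 \in allvars T2 -> (l \in pure (Node v T1 T2) S) = (l \in pure T2 S).
Proof.
have [_ _ _ v2 d] := good_node gT.
move=> l2; rewrite /= !mem_cat.
have -> : (l \in pure T1 S) = false.
  by apply: contraTF l2 => /pure_var/d.
have lv b : (l == (v, b)) = false by apply: contraNF v2 => /eqP lv; rewrite lv in l2.
by case: (act T1 S) (act T2 S) => -[]; rewrite ?inE ?lv ?orbF.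
Qed.

Lemma pure_nodev S b : ((v, b) \in pure (Node v T1 T2) S) =
  if b then act T1 S && ~~ act T2 S else ~~ act T1 S && act T2 S.
Proof.
have [_ _ v1 v2 _] := good_node gT; rewrite /= !mem_cat.
have -> : ((v, b) \in pure T1 S) = false by apply: contraNF v1 => /pure_var.
have -> : ((v, b) \in pure T2 S) = false by apply: contraNF v2 => /pure_var.
by case: b (act T1 S) (act T2 S) => -[] []; rewrite ?inE ?xpair_eqE ?eqxx.
Qed.

(** The boolean, read as 0 or 1, is the price of the root literal; the rest splits because the
    subtrees share no variables. *)
Lemma cost_node S' S : cost (Node v T1 T2) S' S =
  (((act T1 S' && ~~ act T2 S') && ((v, true) \notin pure (Node v T1 T2) S)
   || (~~ act T1 S' && act T2 S') && ((v, false) \notin pure (Node v T1 T2) S))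
  + cost T1 S' S + cost T2 S' S).
Proof.
rewrite {1}/cost; set Q := fun l => l \notin pure (Node v T1 T2) S.
rewrite /= !count_cat addnA; congr (_ + _ + _).
- by rewrite -!/(Q _); case: (act T1 S') (act T2 S') => -[] /=; rewrite ?orbF ?addn0.
- by apply: eq_in_count => l /pure_var l1; rewrite /Q pure_node1.
- by apply: eq_in_count => l /pure_var l2; rewrite /Q pure_node2.
Qed.

Lemma covers_node1 j k S' S : covers j (Node v T1 T2) S' S -> act T1 S' ->
  cost T1 S' S <= k -> covers k T1 S' S.
Proof.
case/and3P => _ /hasPn nc _ a1 c1; rewrite /covers a1 c1 andbT /=.
apply/hasPn => l lS'; rewrite -pure_node1 ?nc // ?(pure_var lS') //.
by rewrite pure_node1 ?(pure_var lS').
Qed.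

Lemma covers_node2 j k S' S : covers j (Node v T1 T2) S' S -> act T2 S' ->
  cost T2 S' S <= k -> covers k T2 S' S.
Proof.
case/and3P => _ /hasPn nc _ a1 c1; rewrite /covers a1 c1 andbT /=.
apply/hasPn => l lS'; rewrite -pure_node2 ?nc // ?(pure_var lS') //.
by rewrite pure_node2 ?(pure_var lS').
Qed.

(** The same list [L] is defeated in both subtrees and the two uncovered sets are united. The union
    meets both sides, so its [pure] contains no root literal. *)
Lemma needs_node k m : needs k T1 m -> needs k T2 m -> needs k.+1 (Node v T1 T2) m.
Proof.
move=> n1 n2 L Lm; have [S1 [a1 S1T c1]] := n1 L Lm; have [S2 [a2 S2T c2]] := n2 L Lm.
have [g1 g2] := (glue1 S1 S2T, glue2 S2 S1T).
have [b1 b2] : act T1 (S1 `|` S2) /\ act T2 (S1 `|` S2).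
  by rewrite (act_ext g1) (act_ext g2).
exists (S1 `|` S2); split; [by rewrite act_node b1|exact: glue_sub|].
move=> S' S'L; apply/negP => cov; have /and3P[aS' _] := cov.
rewrite cost_node !pure_nodev b1 b2 /= !andbT.
move: (c1 _ S'L) (c2 _ S'L); rewrite -(covers_ext _ _ g1) -(covers_ext _ _ g2).
set c1' := cost T1 _ _; set c2' := cost T2 _ _.
have [a1'|a1'] := boolP (act T1 S') => n1' n2' cs.
  (* Meeting [T1] costs more than [k] there: either the root literal comes on top, or [k + 1] is
     used up and nothing is left for [T2]. *)
  have kc1 : k < c1'.
    by rewrite ltnNge; apply/negP => c1k; rewrite (covers_node1 cov) in n1'.
  have [a2'|a2'] := boolP (act T2 S'); last first.
    by move: cs; rewrite (negbTE a2') add1n addSn ltnS => /(leq_trans (leq_addr _ _));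
      rewrite leqNgt kc1.
  rewrite (covers_node2 cov a2') // in n2'; move: cs; rewrite a2' add0n.
  by move: kc1; clear => kc1 c12; have := leq_add kc1 (leqnn c2'); lia.
have a2' : act T2 S' by move: aS'; rewrite act_node (negbTE a1').
rewrite (covers_node2 cov a2') // in n2'; move: cs.
by rewrite a2' /= add1n addSn ltnS; apply: leq_trans; apply: leq_addl.
Qed.

Lemma count_split (L : seq {fset nat}) (a : pred {fset nat}) m : size L < 2 * m ->
  size (seq.filter a L) < m \/ size (seq.filter (predC a) L) < m.
Proof. by move=> Lm; have := count_predC a L; rewrite !size_filter; lia. Qed.

Lemma cost_pos2 S' S : act T2 S' -> ~~ act T2 S -> 0 < cost T2 S' S.
Proof.
have [_ /andP[_ l2] _ _ _] := good_node gT.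
move=> a2 n2; rewrite /cost (pure_inactive n2) -has_count.
by have := pure_neq0 l2 a2; case: (pure T2 S').
Qed.

Lemma cost_pos1 S' S : act T1 S' -> ~~ act T1 S -> 0 < cost T1 S' S.
Proof.
have [/andP[_ l1] _ _ _ _] := good_node gT.
move=> a2 n2; rewrite /cost (pure_inactive n2) -has_count.
by have := pure_neq0 l1 a2; case: (pure T1 S').
Qed.

Lemma act_all T : act T [fset x in prims T].
Proof.
have : prims T != [::] by elim: T => [//|? ? IH1 ? _] /=; case: (prims _) IH1.
rewrite /act; case E: (prims T) => [//|x s] _ /=.
by rewrite !inE eqxx.
Qed.

Lemma act_fset0 T : ~~ act T fset0.
Proof. by apply/hasPn. Qed.

(** Split [L] by whether [T2] is met; one part is shorter than [m] and is defeated in [T1]. If it is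
    the part meeting [T2], add all leaves of [T2]: the other sets pay the root literal. If it is the
    part missing [T2], add nothing: the other sets pay inside [T2]. *)
Lemma needs0_node1 m : needs 0 T1 m -> needs 0 (Node v T1 T2) (2 * m).
Proof.
move=> n1 L /(count_split (act T2))[] Lm.
  have [S1 [a1 S1T c1]] := n1 _ Lm; pose S2 := [fset x in prims T2].
  have S2T : {subset S2 <= prims T2} by move=> x; rewrite /S2 inE.
  have [g1 g2] := (glue1 S1 S2T, glue2 S2 S1T).
  have [b1 b2] : act T1 (S1 `|` S2) /\ act T2 (S1 `|` S2).
    by rewrite (act_ext g1) (act_ext g2) act_all.
  exists (S1 `|` S2); split; [by rewrite act_node b1|exact: glue_sub|].
  move=> S' S'L; apply/negP => cov; have /and3P[aS' _] := cov.
  rewrite cost_node !pure_nodev b1 b2 /= !andbT.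
  case a1': (act T1 S'); case a2': (act T2 S') => //=; last first.
    by rewrite act_node a1' a2' in aS'.
  move=> cs; have /c1/negP : S' \in [seq x <- L | act T2 x] by rewrite mem_filter a2'.
  by rewrite -(covers_ext _ _ g1); apply; apply: (covers_node1 cov) => //;
    apply: leq_trans cs; rewrite -addnA addnCA leq_addr.
have [S1 [a1 S1T c1]] := n1 _ Lm.
have S2T : {subset fset0 <= prims T2} by move=> x; rewrite inE.
have [g1 g2] := (glue1 S1 S2T, glue2 fset0 S1T).
have [b1 b2] : act T1 (S1 `|` fset0) /\ ~~ act T2 (S1 `|` fset0).
  by rewrite (act_ext g1) (act_ext g2) act_fset0.
exists (S1 `|` fset0); split; [by rewrite act_node b1|exact: glue_sub|].
move=> S' S'L; apply/negP => cov; have /and3P[aS' _] := cov.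
rewrite cost_node; case a2': (act T2 S').
  by have := cost_pos2 a2' b2; rewrite lt0n leqn0 !addn_eq0 andbC => /negbTE->.
move=> cs; rewrite act_node a2' orbF in aS'.
have /c1/negP : S' \in [seq x <- L | predC (act T2) x] by rewrite mem_filter /= a2'.
by rewrite -(covers_ext _ _ g1); apply; apply: (covers_node1 cov) => //;
    apply: leq_trans cs; rewrite -addnA addnCA leq_addr.
Qed.

Lemma needs0_node2 m : needs 0 T2 m -> needs 0 (Node v T1 T2) (2 * m).
Proof.
move=> n2 L /(count_split (act T1))[] Lm.
  have [S2 [a2 S2T c2]] := n2 _ Lm; pose S1 := [fset x in prims T1].
  have S1T : {subset S1 <= prims T1} by move=> x; rewrite /S1 inE.
  have [g1 g2] := (glue1 S1 S2T, glue2 S2 S1T).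
  have [b1 b2] : act T1 (S1 `|` S2) /\ act T2 (S1 `|` S2).
    by rewrite (act_ext g1) (act_ext g2) act_all.
  exists (S1 `|` S2); split; [by rewrite act_node b1|exact: glue_sub|].
  move=> S' S'L; apply/negP => cov; have /and3P[aS' _] := cov.
  rewrite cost_node !pure_nodev b1 b2 /= !andbT.
  case a1': (act T1 S'); case a2': (act T2 S') => //=; last first.
    by rewrite act_node a1' a2' in aS'.
  move=> cs; have /c2/negP : S' \in [seq x <- L | act T1 x] by rewrite mem_filter a1'.
  by rewrite -(covers_ext _ _ g2); apply; apply: (covers_node2 cov) => //;
    apply: leq_trans cs; rewrite leq_addl.
have [S2 [a2 S2T c2]] := n2 _ Lm.
have S1T : {subset fset0 <= prims T1} by move=> x; rewrite inE.
have [g1 g2] := (glue1 fset0 S2T, glue2 S2 S1T).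
have [b1 b2] : ~~ act T1 (fset0 `|` S2) /\ act T2 (fset0 `|` S2).
  by rewrite (act_ext g1) (act_ext g2) act_fset0.
exists (fset0 `|` S2); split; [by rewrite act_node b2 orbT|exact: glue_sub|].
move=> S' S'L; apply/negP => cov; have /and3P[aS' _] := cov.
rewrite cost_node; case a1': (act T1 S').
  by have := cost_pos1 a1' b1; rewrite lt0n leqn0 !addn_eq0 => /negbTE->; rewrite andbF.
move=> cs; rewrite act_node a1' in aS'.
have /c2/negP : S' \in [seq x <- L | predC (act T1) x] by rewrite mem_filter /= a1'.
by rewrite -(covers_ext _ _ g2); apply; apply: (covers_node2 cov) => //;
    apply: leq_trans cs; rewrite leq_addl.
Qed.

End Node.

Lemma needs1 k T : needs k T 1.
Proof.
move=> [|//] _; exists [fset x in prims T]; split=> //; first exact: act_all.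
by move=> x; rewrite inE.
Qed.

Lemma needs0_height T : good T -> needs 0 T (2 ^ height T).
Proof.
elim: T => [us _|v T1 IH1 T2 IH2 gT]; first exact: needs1.
have [g1 g2 _ _ _] := good_node gT; rewrite /= expnS.
case: (leqP (height T1) (height T2)) => _.
  by apply: needs0_node2 => //; apply: IH2.
by apply: needs0_node1 => //; apply: IH1.
Qed.

(** Unless [C] contains [(v, false)], it is an implicate of [T1] as well, since [v] may be set to
    false; likewise for [(v, true)] and [T2]. So a root literal in [C] leaves one subtree to recurse
    into and is the pure literal there; without one, both subtrees are used. *)
Lemma implicate_pure T C : good T -> is_clause C ->
  (forall f, eval T f -> has (lit_val f) C) ->
  exists S, [/\ act T S, {subset S <= prims T} & {subset pure T S <= C}].
Proof.
move=> + cC; elim: T => [us|v T1 IH1 T2 IH2] gT TC.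
  exists [fset head 0 us]; split=> [|x|l]; rewrite ?/act /= ?inE ?eqxx //.
  case/mapP => u uus ->; apply/negPn/negP => nuC.
  (* This satisfies the leaf and falsifies [C] off [u], so [C] must contain [u] positively. *)
  pose f x := (x == u) || falsify C x.
  have /hasP[[x b] lC] : has (lit_val f) C.
    by apply: TC => /=; apply/hasP; exists u; rewrite // /f eqxx.
  rewrite /lit_val /f /=; have [xu|_] := eqVneq x u.
    by rewrite xu in lC; case: b lC => // uC _; rewrite uC in nuC.
  by apply/negP; exact: (falsifyP cC lC).
have [g1 g2 v1 v2 d] := good_node gT.
pose upd f b x := if x == v then b else f x : bool.
have updT f b T : v \notin allvars T -> eval T (upd f b) = eval T f.
  move=> vT; apply: eq_eval => x xT; rewrite /upd.
  by case: eqP => // xv; rewrite -xv xT in vT.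
have updC f b : (v, b) \notin C -> has (lit_val (upd f b)) C -> has (lit_val f) C.
  move=> vC /hasP[[x c] lC]; rewrite /lit_val /upd /=; have [xv|_] := eqVneq x v => fx.
    by move: vC; rewrite (eqP fx) -xv lC.
  by apply/hasP; exists (x, c).
have E1 : (v, false) \notin C -> exists S,
    [/\ act T1 S, {subset S <= prims T1} & {subset pure T1 S <= C}].
  move=> vC; apply: IH1 => // f fT; apply: (updC _ _ vC); apply: TC.
  by rewrite /= {1}/upd eqxx updT.
have E2 : (v, true) \notin C -> exists S,
    [/\ act T2 S, {subset S <= prims T2} & {subset pure T2 S <= C}].
  move=> vC; apply: IH2 => // f fT; apply: (updC _ _ vC); apply: TC.
  by rewrite /= {1}/upd eqxx updT.
have e1 : {subset fset0 <= prims T1} by move=> x; rewrite inE.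
have e2 : {subset fset0 <= prims T2} by move=> x; rewrite inE.
have [vC|vC] := boolP ((v, true) \in C).
  have [S1 [a1 S1T p1]] := E1 (cC _ vC).
  have [h1 h2] := (glue1 gT S1 e2, glue2 gT fset0 S1T).
  exists (S1 `|` fset0); split; [|exact: glue_sub|].
    by rewrite act_node (act_ext h1) a1.
  rewrite /= (act_ext h1) (act_ext h2) (pure_ext h1) (pure_ext h2) a1.
  rewrite (negbTE (act_fset0 _)) [pure T2 _]pure_inactive ?act_fset0 // cats0 => l.
  by rewrite inE => /orP[/eqP->|/p1].
have [S2 [a2 S2T p2]] := E2 vC.
have [vC'|vC'] := boolP ((v, false) \in C).
  have [h1 h2] := (glue1 gT fset0 S2T, glue2 gT S2 e1).
  exists (fset0 `|` S2); split; [|exact: glue_sub|].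
    by rewrite act_node (act_ext h2) a2 orbT.
  rewrite /= (act_ext h1) (act_ext h2) (pure_ext h1) (pure_ext h2) a2.
  rewrite (negbTE (act_fset0 _)) [pure T1 _]pure_inactive ?act_fset0 // => l.
  by rewrite inE => /orP[/eqP->|/p2].
have [S1 [a1 S1T p1]] := E1 vC'.
have [h1 h2] := (glue1 gT S1 S2T, glue2 gT S2 S1T).
exists (S1 `|` S2); split; [|exact: glue_sub|].
  by rewrite act_node (act_ext h2) a2 orbT.
rewrite /= (act_ext h1) (act_ext h2) (pure_ext h1) (pure_ext h2) a1 a2 /= => l.
by rewrite mem_cat => /orP[/p1|/p2].
Qed.

Lemma seq_choice (A B : eqType) (s : seq A) (R : A -> B -> Prop) :
  (forall x, x \in s -> exists y, R x y) ->
  exists L, size L = size s /\ forall x, x \in s -> exists2 y, y \in L & R x y.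
Proof.
elim: s => [|x s IH] xR; first by exists [::].
have [|L [Ls LR]] := IH; first by move=> y ys; apply: xR; rewrite inE ys orbT.
have [y xy] := xR x (mem_head _ _).
exists (y :: L); split=> [|z]; first by rewrite /= Ls.
rewrite inE => /orP[/eqP->|/LR[t tL zt]]; first by exists y; rewrite ?mem_head.
by exists t; rewrite // inE tL orbT.
Qed.

(** * Clause-sets equivalent to a doped tree *)

Lemma equivalent_sym F G : equivalent F G -> equivalent G F.
Proof. by move=> FG C; split=> /FG. Qed.

Lemma equivalent_satisfiable F G : equivalent F G -> satisfiable G -> satisfiable F.
Proof.
move=> FG /satisfiableP[g gG]; have [//|nF] := pselect (satisfiable F).
have c0 : is_clause fset0 by move=> l; rewrite inE.
have F0 : entails F fset0 by move=> phi sF; case: nF; exists phi.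
by have /(entailsP _ c0)/(_ _ gG) := equivalent_entails FG c0 F0.
Qed.

Lemma equivalent_lower_bound T k m F : good T -> needs k T m ->
  is_clause_set F -> equivalent F (doped T) -> WC k F -> m <= nclauses F.
Proof.
move=> gT nT cF eF wF; have /andP[uT lT] := gT.
rewrite leqNgt; apply/negP => Fm.
have sF : satisfiable F by apply: equivalent_satisfiable eF (doped_satisfiable lT).
(* One set of leaves for each clause of [F]: the clause is an implicate and hence contains some
   [pure T S]. *)
have [|L [LF LP]] := @seq_choice _ _ (enum_fset F)
    (fun C S => act T S /\ {subset pure T S <= C}).
  move=> C CF; have [|S [aS _ SC]] := implicate_pure gT (cF _ CF); last by exists S.
  have FC : entails F C by move=> phi /papply_eq0; apply.
  have /(entailsP _ (cF _ CF)) DC := equivalent_entails eF (cF _ CF) FC.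
  by move=> f fT; apply: DC; apply/models_doped.
have [|S [aS _ SL]] := nT L; first by rewrite LF.
pose P := [fset l in pure T S].
have cP : is_clause P by move=> l; rewrite !in_clause; apply: pure_compl.
have FP : entails F P.
  apply: (equivalent_entails (equivalent_sym eF) cP); apply: (iffRL (entailsP _ cP)) => f.
  by move=> /models_doped fT; rewrite has_fset pure_sat.
(* Falsifying the implicate [P] leaves no model, so some clause of [F] shrinks to at most [k]
   literals. *)
have [|D] := WC_narrow cF sF wF (phi := falsify_on P).
- case/satisfiable_papply => f [fP fF].
  have /hasP[l lP vl] : has (lit_val f) P by exact: (iffLR (entailsP _ cP) FP).
  have : lit_false (falsify_on P) l by rewrite lit_false_on.
  by move/(extends_lit_false fP); rewrite vl.
case/papplyP => C [CF nsC ->] Dk.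
have [S' S'L [aS' S'C]] := LP _ CF.
move/negP: (SL _ S'L); apply; apply/and3P; split=> //.
  (* A literal complementary to one of [P] would be true, and the clause would have been removed. *)
  apply/hasPn => l /S'C lC; apply: contra nsC => clP; apply/hasP; exists l => //.
  have : lit_false (falsify_on P) (compl l) by rewrite lit_false_on // /P in_clause.
  by rewrite /lit_true /lit_false /= negbK.
(* The literals counted by [cost] are distinct and survive in the shrunken clause. *)
apply: leq_trans Dk; rewrite /cost -size_filter; apply: uniq_leq_size.
  exact/filter_uniq/pure_uniq.
move=> l; rewrite mem_filter => /andP[nlS /S'C lC].
by rewrite in_freduct lC lit_false_on // in_clause.
Qed.

End LowerBound.

(** * Extremal trees *)

Section TreeSizes.
Local Open Scope fset_scope.
Local Open Scope nat_scope.

Implicit Types (P : seq literal) (C : clause) (k h j : nat).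

Fixpoint nleaves A B (T : btree A B) : nat :=
  match T with
  | Leaf _ => 1
  | Node _ T1 T2 => nleaves T1 + nleaves T2
  end.

Lemma nnodes_nleaves A B (T : btree A B) : (nnodes T).+1 = 2 * nleaves T.
Proof. by elim: T => //= ? T1 h1 T2 h2; rewrite mulnDr -h1 -h2 addnS. Qed.

(** The largest number of leaves for Horton-Strahler number at most [k] and height at most [h], by
    [nleaves_le] and [largestP]. *)
Definition max_leaves k h := \sum_(i < k.+1) 'C(h, i).

Lemma max_leavesS k h : max_leaves k.+1 h.+1 = max_leaves k h + max_leaves k.+1 h.
Proof.
rewrite /max_leaves big_ord_recl bin0 [in RHS]addnC [X in _ = X + _]big_ord_recl bin0.
rewrite -addnA; congr (_ + _)%N.
by rewrite -big_split /=; apply: eq_bigr => i _; rewrite binS.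
Qed.

Lemma max_leaves_gt0 k h : 0 < max_leaves k h.
Proof. by rewrite /max_leaves big_ord_recl bin0. Qed.

Lemma max_leaves_height0 k : max_leaves k 0 = 1.
Proof. by rewrite /max_leaves big_ord_recl bin0 big1 // => i _; rewrite bin0n. Qed.

Lemma max_leaves_hts0 h : max_leaves 0 h = 1.
Proof. by rewrite /max_leaves big_ord_recl big_ord0 bin0. Qed.

(** The Horton-Strahler number of one subtree is strictly below the bound, which matches Pascal's
    rule in [max_leavesS]. *)
Lemma nleaves_le A B (T : btree A B) k h :
  hts T <= k -> height T <= h -> nleaves T <= max_leaves k h.
Proof.
elim: T k h => [b|a T1 IH1 T2 IH2] k h; first by rewrite /= max_leaves_gt0.
rewrite [hts _]/= -/(hts_node _ _) [height _]/= [nleaves _]/=.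
case: h => // h; rewrite ltnS geq_max => + /andP[hh1 hh2].
case: k => [|k]; first by rewrite /hts_node; case: eqP => // + /[!leqn0] /eqP; lia.
move=> hk; rewrite max_leavesS.
have [h1|h2] : hts T1 <= k /\ hts T2 <= k.+1 \/ hts T2 <= k /\ hts T1 <= k.+1.
- by move: hk; rewrite /hts_node; case: eqP; lia.
- by apply: leq_add; [apply: IH1; case: h1|apply: IH2; case: h1].
- by rewrite addnC; apply: leq_add; [apply: IH2; case: h2|apply: IH1; case: h2].
Qed.

Fixpoint largest k h : btree unit unit :=
  match h, k with
  | h'.+1, k'.+1 => Node tt (largest k' h') (largest k h')
  | _, _ => Leaf tt
  end.

Lemma largestP k h :
  [/\ hts (largest k h) <= k, height (largest k h) <= h
    & nleaves (largest k h) = max_leaves k h].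
Proof.
elim: h k => [|h IH] [|k] /=; rewrite ?max_leaves_height0 ?max_leaves_hts0 //.
have [a1 b1 c1] := IH k; have [a2 b2 c2] := IH k.+1.
rewrite max_leavesS c1 c2; split=> //; last by lia.
by rewrite -/(hts_node _ _) /hts_node; case: eqP; lia.
Qed.

(** Unlike extremality, this passes to subtrees, whose bounds may fail to be an allowed pair. *)
Definition saturated A B k h (T : btree A B) :=
  [/\ hts T <= k, height T <= h & nleaves T = max_leaves k h].

Lemma extremal_saturated A B k h (T : btree A B) : extremal k h T -> saturated k h T.
Proof.
case=> _ hk hh mx; split; rewrite ?hk ?hh //.
apply/eqP; rewrite eqn_leq nleaves_le ?hk ?hh //=.
have [a b <-] := largestP k h; have := mx _ a b.
by rewrite -ltnS !nnodes_nleaves leq_mul2l.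
Qed.

(** For positive [k] the maximal number of leaves strictly grows with [h]. *)
Lemma saturated_height A B k h (T : btree A B) : 0 < k -> saturated k h T -> height T = h.
Proof.
case: k => // k _ [hk hh nT]; apply/eqP; rewrite eqn_leq hh leqNgt.
case: h hh nT => // h _ nT; rewrite ltnS; apply/negP => hh.
have := nleaves_le hk hh; rewrite nT max_leavesS.
by have := max_leaves_gt0 k h; lia.
Qed.

Lemma saturated_node A B k h a (T1 T2 : btree A B) : saturated k h (Node a T1 T2) ->
  exists k' h', [/\ k = k'.+1, h = h'.+1 &
    saturated k' h' T1 /\ saturated k h' T2 \/ saturated k' h' T2 /\ saturated k h' T1].
Proof.
case; rewrite [hts _]/= -/(hts_node _ _) [height _]/= [nleaves _]/=.
case: h => // h; rewrite ltnS geq_max => + /andP[hh1 hh2].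
case: k => [|k]; first by rewrite /hts_node; case: eqP => // + /[!leqn0] /eqP; lia.
move=> hk; rewrite max_leavesS => nT; exists k, h; split=> //.
have [[h1 h2]|[h2 h1]] : hts T1 <= k /\ hts T2 <= k.+1 \/ hts T2 <= k /\ hts T1 <= k.+1.
- by move: hk; rewrite /hts_node; case: eqP; lia.
- left; move: (nleaves_le h1 hh1) (nleaves_le h2 hh2) => ? ?.
  by split; split=> //; lia.
- right; move: (nleaves_le h1 hh1) (nleaves_le h2 hh2) => ? ?.
  by split; split=> //; lia.
Qed.

(** Going down, [h] and [j] drop by one and [k] by at most one. So [h - j] is kept and [j < k]
    persists, until the height is known to equal its bound. *)
Lemma saturated_needs (T : btree nat (seq nat)) k h j :
  good T -> saturated k h T -> j < k -> needs j T (2 ^ (h - j)).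
Proof.
elim: j T k h => [|j IH] T k h gT sT jk.
  by rewrite subn0 -(saturated_height _ sT) //; apply: needs0_height.
case: T gT sT => [us _ sT|v T1 T2 gT sT].
  by rewrite -(saturated_height _ sT) /=; [apply: needs1|apply: leq_trans jk].
have [g1 g2 _ _ _] := good_node gT.
have [k' [h' [kk hh {}sT]]] := saturated_node sT.
move: jk; rewrite kk ltnS hh subSS => jk; apply: needs_node => //.
  by case: sT => -[s1 s2]; [apply: (IH _ _ _ g1 s1)|apply: (IH _ _ _ g1 s2)]; lia.
by case: sT => -[s1 s2]; [apply: (IH _ _ _ g2 s2)|apply: (IH _ _ _ g2 s1)]; lia.
Qed.

Lemma gen_uniq (T : btree nat (seq nat)) P : uniq (allvars T) -> fresh T P ->
  {in P, forall l, compl l \notin P} ->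
  uniq [seq [fset l in c] | c <- gen T P].
Proof.
elim: T P => [//|v T1 IH1 T2 IH2] P uT dT cP /=.
have [v1 v2 u1 u2] := uniq_node uT; have fT b := fresh_node uT dT b.
have cPv b : {in (v, b) :: P, forall l, compl l \notin (v, b) :: P}.
  by apply: compl_cons => // c'; apply: dT; rewrite mem_head.
rewrite map_cat cat_uniq IH1 ?IH2 ?andbT //=; try by case: (fT true); case: (fT false).
(* Clauses from different subtrees differ: one contains [(v, true)], the other its complement. *)
apply/hasPn => _ /mapP[c1 c1T ->]; apply/mapP => -[c2 c2T /fsetP E].
have m1 := gen_prefix c1T (mem_head _ _); have m2 := gen_prefix c2T (mem_head _ _).
have := gen_clause u2 (fT false).2 (cPv _) c2T m2.
by move: (E (v, true)); rewrite !in_clause m1 => <-.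
Qed.

Lemma card_clauses_of (cs : seq (seq literal)) :
  uniq [seq [fset l in c] | c <- cs] -> #|` clauses_of cs| = size cs.
Proof.
move=> ucs; have -> : clauses_of cs = [fset C in [seq [fset l in c] | c <- cs]].
  apply/fsetP => C; rewrite in_fset /=.
  by apply/clauses_ofP/mapP => -[c cs_c ->]; exists c.
by rewrite card_fseq undup_id // size_map.
Qed.

Lemma size_gen (T : btree nat (seq nat)) P : size (gen T P) = nleaves T.
Proof. by elim: T P => //= v T1 IH1 T2 IH2 P; rewrite size_cat IH1 IH2 addnC. Qed.

Lemma nclauses_doped (T : btree nat (seq nat)) :
  uniq (allvars T) -> nclauses (doped T) = nleaves T.
Proof. by move=> uT; rewrite /nclauses card_clauses_of ?size_gen // gen_uniq. Qed.

Lemma gen_vars (T : btree nat (seq nat)) P x :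
  has (has (fun l => l.1 == x)) (gen T P) = (x \in allvars T) || has (fun l => l.1 == x) P.
Proof.
elim: T P => [us|v T1 IH1 T2 IH2] P /=.
  rewrite orbF has_cat has_map; congr (_ || _).
  by rewrite -has_pred1; apply: eq_has => u; rewrite /= eq_sym.
rewrite has_cat IH1 IH2 /= inE mem_cat [v == x]eq_sym.
by case: (x == v) (x \in allvars T1) (x \in allvars T2) (has _ P) => -[] [] [].
Qed.

Lemma var_doped (T : btree nat (seq nat)) : var (doped T) =i allvars T.
Proof.
move=> x; have := gen_vars T [::] x; rewrite orbF => <-.
apply/varP/hasP => [[_ [b [/clauses_ofP[c cT ->]]]]|[c cT /hasP[[y b] lc /eqP /= yx]]].
  by rewrite in_clause => lc; exists c => //; apply/hasP; exists (x, b) => /=.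
by exists [fset l in c], b; split; [apply/clauses_ofP; exists c|rewrite in_clause -yx].
Qed.

Lemma nvars_doped (T : btree nat (seq nat)) :
  uniq (allvars T) -> nvars (doped T) = size (allvars T).
Proof.
move=> uT; rewrite /nvars; apply/perm_size/uniq_perm => //.
exact: var_doped.
Qed.

(** * Doping the clause-set of a tree *)

Implicit Types (T : btree nat unit) (u : clause -> nat).

(** With empty leaf labels [gen] produces the clauses of [F1], so facts about [gen] apply to both
    clause-sets. *)
Fixpoint undoped T : btree nat (seq nat) :=
  match T with
  | Leaf _ => Leaf [::]
  | Node v T1 T2 => Node v (undoped T1) (undoped T2)
  end.

Fixpoint dope u T P : btree nat (seq nat) :=
  match T with
  | Leaf _ => Leaf [:: u [fset l in P]]
  | Node v T1 T2 => Node v (dope u T1 ((v, true) :: P)) (dope u T2 ((v, false) :: P))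
  end.

Lemma saturated_dope k h u T P : saturated k h T -> saturated k h (dope u T P).
Proof.
suff [e1 e2 e3] : [/\ hts (dope u T P) = hts T, height (dope u T P) = height T
                    & nleaves (dope u T P) = nleaves T].
  by rewrite /saturated e1 e2 e3.
by elim: T P => //= v T1 IH1 T2 IH2 P; case: (IH1 ((v, true) :: P)) => -> -> ->;
  case: (IH2 ((v, false) :: P)) => -> -> ->.
Qed.

Lemma F1_undoped T : F1 T = doped (undoped T).
Proof.
(* The two listings order clauses and literals differently, so they are compared as sets, for an
   arbitrary path [P]. *)
suff E P C : (exists2 c, c \in leaf_paths T & C = [fset l in c ++ P]) <->
             (exists2 c, c \in gen (undoped T) P & C = [fset l in c]).
  apply/fsetP => C; apply/clauses_ofP/clauses_ofP.
    by case=> c cT ->; apply/E; exists c; rewrite ?cats0.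
  by move/E => -[c cT ->]; exists c; rewrite ?cats0.
elim: T P C => [[]|v T1 IH1 T2 IH2] P C /=.
  by split=> -[c]; rewrite inE => /eqP-> ->; [exists P|exists [::]]; rewrite ?mem_head.
have swap (c : seq literal) l : [fset l' in (l :: c) ++ P] = [fset l' in c ++ l :: P].
  by apply/fsetP => l'; rewrite !in_clause !inE !mem_cat inE orbCA.
split=> -[c]; rewrite mem_cat => /orP[].
- case/mapP => c' c'T -> ->; rewrite swap.
  have /IH1[d dT ->] : exists2 c, c \in leaf_paths T1 &
    [fset l in c' ++ (v, true) :: P] = [fset l in c ++ (v, true) :: P] by exists c'.
  by exists d; rewrite // mem_cat dT orbT.
- case/mapP => c' c'T -> ->; rewrite swap.
  have /IH2[d dT ->] : exists2 c, c \in leaf_paths T2 &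
    [fset l in c' ++ (v, false) :: P] = [fset l in c ++ (v, false) :: P] by exists c'.
  by exists d; rewrite // mem_cat dT.
- move=> cT ->; have /IH2[d dT ->] : exists2 d, d \in gen (undoped T2) ((v, false) :: P) &
    [fset l in c] = [fset l in d] by exists c.
  by exists ((v, false) :: d); rewrite ?swap // mem_cat map_f ?orbT.
- move=> cT ->; have /IH1[d dT ->] : exists2 d, d \in gen (undoped T1) ((v, true) :: P) &
    [fset l in c] = [fset l in d] by exists c.
  by exists ((v, true) :: d); rewrite ?swap // mem_cat map_f.
Qed.

Lemma gen_dope u T P : gen (dope u T P) P =
  [seq (u [fset l in c], true) :: c | c <- gen (undoped T) P].
Proof. by elim: T P => //= v T1 IH1 T2 IH2 P; rewrite map_cat IH1 IH2. Qed.

Lemma doping_dope u T : doping (F1 T) u = doped (dope u T [::]).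
Proof.
rewrite /doping /doped gen_dope F1_undoped; apply/fsetP => C.
have fset_cons (l : literal) (c : seq literal) : [fset x in l :: c] = l |` [fset x in c].
  by apply/fsetP => x; rewrite in_fset1U !in_clause inE.
apply/imfsetP/clauses_ofP => /=.
  case=> D /clauses_ofP[c cT ->] ->.
  by exists ((u [fset l in c], true) :: c); [apply/mapP; exists c|].
case=> _ /mapP[c cT ->] ->; exists [fset l in c]; last exact: fset_cons.
by apply/clauses_ofP; exists c.
Qed.

Lemma allvars_undoped T : allvars (undoped T) = inner_labels T.
Proof. by elim: T => //= v T1 -> T2 ->. Qed.

Lemma allvars_dope u T P : perm_eq (allvars (dope u T P))
  (inner_labels T ++ [seq u [fset l in c] | c <- gen (undoped T) P]).
Proof.
elim: T P => //= v T1 IH1 T2 IH2 P; rewrite perm_cons map_cat.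
apply: perm_trans (perm_cat (IH1 _) (IH2 _)) _.
by rewrite perm_catACA perm_cat2l perm_catC.
Qed.

Lemma good_dope u T : uniq (inner_labels T) -> doping_vars (F1 T) u ->
  good (dope u T [::]).
Proof.
move=> uT [uinj uvar]; have uU : uniq (allvars (undoped T)) by rewrite allvars_undoped.
apply/andP; split; last first.
  by elim: T [::] {uT uinj uvar uU} => //= v T1 IH1 T2 IH2 P; rewrite IH1 IH2.
rewrite (perm_uniq (allvars_dope _ _ _)) cat_uniq uT /=.
have inF1 c : c \in gen (undoped T) [::] -> [fset l in c] \in F1 T.
  by move=> cT; rewrite F1_undoped; apply/clauses_ofP; exists c.
apply/andP; split.
  apply/hasPn => _ /mapP[c /inF1/uvar + ->]; apply: contra.
  by rewrite F1_undoped var_doped allvars_undoped.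
(* Distinct leaves give distinct clauses, on which [u] is injective. *)
rewrite (map_comp u (fun c : seq literal => [fset l in c])) map_inj_in_uniq.
  exact: gen_uniq.
move=> _ _ /mapP[c cT ->] /mapP[d dT ->]; apply: uinj; exact: inF1.
Qed.

Lemma size_allvars_dope u T P : size (allvars (dope u T P)) = nnodes T.
Proof.
rewrite (perm_size (allvars_dope _ _ _)) size_cat size_map size_gen.
by elim: T => //= v T1 <- T2 <-; rewrite size_cat; lia.
Qed.

End TreeSizes.

(** * Growth of sums of binomial coefficients *)

Section Growth.
Local Open Scope nat_scope.

Lemma ffact_le_exp n m : n ^_ m <= n ^ m.
Proof.
elim: m => [//|m IH]; rewrite ffactnSr expnSr leq_mul ?leq_subr //.
Qed.

Lemma exp_le_ffact n m i : m <= n -> i <= m -> (n - m).+1 ^ i <= n ^_ i.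
Proof.
move=> mn; elim: i => [//|i IH] im; rewrite ffactnSr expnSr leq_mul ?IH //; lia.
Qed.

Lemma max_leaves_le m h : 0 < h -> max_leaves m h <= m.+1 * h ^ m.
Proof.
move=> h0; have -> : m.+1 * h ^ m = \sum_(i < m.+1) h ^ m by rewrite sum_nat_const card_ord.
apply: leq_sum => i _; apply: (@leq_trans (h ^ i)); last first.
  by rewrite leq_pexp2l // -ltnS.
apply: leq_trans (ffact_le_exp h i); rewrite -bin_ffact leq_pmulr //.
exact: fact_gt0.
Qed.

Lemma max_leaves_ge m h : 0 < m -> m <= h -> h ^ m <= m ^ m * m`! * max_leaves m h.
Proof.
move=> m0 mh; apply: (@leq_trans (m ^ m * (m`! * 'C(h, m)))).
  rewrite [m`! * _]mulnC bin_ffact -(leq_pmul2l (m0 : 0 < m)) leq_pmul2l //.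
  (* [h <= m * (h - m + 1)], the difference being [(m - 1) * (h - m)]. *)
  apply: (@leq_trans ((m * (h - m).+1) ^ m)).
    by rewrite leq_exp2r //; nia.
  by rewrite expnMn leq_mul ?exp_le_ffact.
rewrite mulnA leq_mul //.
by rewrite /max_leaves (bigD1 ord_max) //= leq_addr.
Qed.

End Growth.

(** * Asymptotics of the extremal family *)

Section Asymptotics.
Local Open Scope classical_set_scope.
Local Open Scope ring_scope.

Lemma natr_Omega (R : realType) (f : nat -> nat) (g : nat -> R) (c : R) N : 0 < c ->
  (forall h, (N <= h)%N -> c * `|g h| <= (f h)%:R) ->
  (fun h => (f h)%:R : R) =Omega_\oo g.
Proof.
move=> c0 fg; rewrite eqOmegaE qualifE; apply/asboolP; exists c => //.
near=> h; rewrite [leRHS]ger0_norm //; apply: fg; near: h; exact: nbhs_infty_ge.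
Unshelve. all: by end_near. Qed.

Lemma natr_Theta (R : realType) (f g : nat -> nat) A B N :
  (forall h, (N <= h)%N -> (f h <= A * g h)%N /\ (g h <= B * f h)%N) ->
  (fun h => (f h)%:R : R) =Theta_\oo (fun h => (g h)%:R : R).
Proof.
move=> fg; rewrite eqThetaE bigThetaE; split.
  apply/eqO_exP; exists A.+1%:R; first exact: ltr0Sn.
  near=> h; rewrite !ger0_norm // -natrM ler_nat.
  have [|fA _] := fg h; first by near: h; exact: nbhs_infty_ge.
  by rewrite (leq_trans fA) // leq_mul2r leqnSn orbT.
rewrite -eqOmegaE; apply: (@natr_Omega _ _ _ (B.+1%:R^-1) N).
  by rewrite invr_gt0 ltr0Sn.
move=> h /fg[_ gB]; rewrite ger0_norm // ler_pdivrMl ?ltr0Sn // -natrM ler_nat.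
by rewrite (leq_trans gB) // leq_mul2r leqnSn orbT.
Unshelve. all: by end_near. Qed.

Lemma extremal_doping (R : realType) (k : nat)
    (T : nat -> btree nat unit) (u : nat -> clause -> nat) :
  (forall h : nat, (k.+1 <= h)%N ->
     [/\ extremal k.+1 h (T h), uniq (inner_labels (T h))
       & doping_vars (F1 (T h)) (u h)]) ->
  let F h := doping (F1 (T h)) (u h) in
  [/\ (fun h => (nvars (F h))%:R : R) =Theta_\oo (fun h => h%:R ^+ k.+1),
      (fun h => (nclauses (F h))%:R : R) =Theta_\oo (fun h => h%:R ^+ k.+1),
      forall h : nat, (k.+1 <= h)%N -> UC k.+1 (F h)
    & forall F' : nat -> clause_set,
        (forall h : nat, (k.+1 <= h)%N ->
           [/\ is_clause_set (F' h), equivalent (F' h) (F h)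
             & WC k (F' h)]) ->
        (fun h => (nclauses (F' h))%:R : R)
          =Omega_\oo (fun h => 2 ^+ h / Num.sqrt h%:R)].
Proof.
move=> hyp F.
have D h : (k.+1 <= h)%N -> [/\ good (dope (u h) (T h) [::]),
    saturated k.+1 h (dope (u h) (T h) [::]), F h = doped (dope (u h) (T h) [::]),
    nclauses (F h) = max_leaves k.+1 h & (nvars (F h)).+1 = (2 * max_leaves k.+1 h)%N].
  move=> /hyp[eT uT dT]; have sT := extremal_saturated eT.
  have gT := good_dope uT dT; have /andP[ud _] := gT.
  have sD : saturated k.+1 h (dope (u h) (T h) [::]) by exact: saturated_dope.
  have [_ _ nT] := sT; have [_ _ nD] := sD.
  split; rewrite // /F doping_dope ?nclauses_doped ?nvars_doped //.
  by rewrite size_allvars_dope nnodes_nleaves nT.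
have X : (fun h => h%:R ^+ k.+1 : R) = (fun h => (h ^ k.+1)%:R).
  by apply/funext => h; rewrite natrX.
split.
(* With M leaves there are 2M - 1 variables, a number between M and 2M as M >= 1. *)
- rewrite X; apply: (@natr_Theta _ _ _ (2 * k.+2) (k.+1 ^ k.+1 * k.+1`!) k.+1) => h kh.
  have [_ _ _ _ nF] := D h kh.
  have := @max_leaves_ge k.+1 h isT kh; have := @max_leaves_le k.+1 h (leq_trans _ kh).
  have := max_leaves_gt0 k.+1 h.
  move: nF; set M := max_leaves _ _ => nF M0 /(_ isT) up lo; split.
    rewrite -mulnA -ltnS nF; apply: leqW; exact: leq_mul.
  by apply: leq_trans lo _; rewrite leq_mul2l; apply/orP; right; lia.
- rewrite X; apply: (@natr_Theta _ _ _ k.+2 (k.+1 ^ k.+1 * k.+1`!) k.+1) => h kh.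
  have [_ _ _ -> _] := D h kh.
  by split; [apply: max_leaves_le; apply: leq_trans kh|apply: max_leaves_ge].
- by move=> h /D[gT [hT _ _] -> _ _]; apply: doped_UC.
(* The clause count is at least 2^(h-k), hence the constant 2^-k; division by sqrt h >= 1 only
   lowers the right-hand side. *)
move=> F' hF'; apply: (@natr_Omega _ _ _ (2 ^- k) k.+1).
  by rewrite invr_gt0 exprn_gt0.
move=> h kh; have [gT sT FT _ _] := D h kh; have [cF' eF' wF'] := hF' h kh.
rewrite FT in eF'.
have lb := equivalent_lower_bound gT (saturated_needs gT sT (leqnn _)) cF' eF' wF'.
apply: (@le_trans _ _ (2 ^ (h - k))%:R); last by rewrite ler_nat.
have kh' : (k <= h)%N by apply: ltnW.
have s1 : 1 <= Num.sqrt (h%:R : R).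
  by rewrite -[leLHS]sqrtr1 ler_wsqrtr // ler1n; apply: leq_trans kh.
rewrite ger0_norm ?divr_ge0 ?exprn_ge0 ?sqrtr_ge0 // natrX.
rewrite ler_pdivrMl ?exprn_gt0 // -exprD subnKC //.
rewrite ler_pdivrMr ?(lt_le_trans ltr01) //.
by rewrite ler_peMr // exprn_ge0.
Qed.

End Asymptotics.

(** * Polynomial time *)

Section Programs.
Local Open Scope nat_scope.

Implicit Types (s : store) (p q : prog) (r t : nat).
Implicit Types (l : seq (seq bool)) (P R : seq literal).

Definition upd s r x : store := [eta s with r |-> x].

Lemma updE s r x r' : upd s r x r' = if r' == r then x else s r'.
Proof. by []. Qed.

Lemma exec_eq p s s' s'' t : exec p s s'' t -> s'' =1 s' -> exec p s s' t.
Proof. by move=> e /funext <-. Qed.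

(** The scratch stack of [copy], empty before and after each use. *)
Definition tmp := 7.

(** Moving [r] to the scratch stack reverses it; moving it back onto [r] and [r'] at once restores
    the order. *)
Definition copy r r' :=
  Seq (While r (Case r (Seq (Pop r) (Push tmp true)) (Seq (Pop r) (Push tmp false)) Skip))
      (While tmp (Case tmp (Seq (Pop tmp) (Seq (Push r true) (Push r' true)))
                           (Seq (Pop tmp) (Seq (Push r false) (Push r' false))) Skip)).

Lemma exec_copy r r' s : r != r' -> r != tmp -> r' != tmp -> s tmp = [::] ->
  exec (copy r r') s (upd s r' (s r ++ s r')) (9 * size (s r) + 2).
Proof.
move=> rr' rt r't s0.
have out x s1 : s1 r = x -> exec (While r (Case r (Seq (Pop r) (Push tmp true))
      (Seq (Pop r) (Push tmp false)) Skip)) s1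
    (upd (upd s1 r [::]) tmp (rev x ++ s1 tmp)) (4 * size x + 1).
  elim: x s1 => [|b x IH] s1 sr.
    apply: exec_eq (ExecWhileStop _ sr) _ => r1; rewrite !updE.
    by case: eqP => [->|_] //; case: eqP => [->|].
  pose s2 := upd (upd s1 r x) tmp (b :: s1 tmp).
  have e1 : exec (Case r (Seq (Pop r) (Push tmp true)) (Seq (Pop r) (Push tmp false)) Skip)
      s1 s2 3.
    apply: ExecCase; rewrite sr.
    have e2 : exec (Seq (Pop r) (Push tmp b)) s1 s2 (1 + 1).
      apply: ExecSeq (ExecPop _ _) _; apply: exec_eq (ExecPush _ _ _) _ => r1.
      by rewrite /s2 !updE /= sr [tmp == r]eq_sym (negbTE rt).
    by case: (b) e2.
  have : s2 r = x by rewrite /s2 !updE (negbTE rt) eqxx.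
  move/IH => e2; rewrite (_ : 4 * _ + 1 = (3 + (4 * size x + 1)).+1) /=; last by lia.
  apply: ExecWhileStep e1 _; first by rewrite sr.
  apply: exec_eq e2 _ => r1; rewrite /s2 !updE eqxx.
  case: eqP => [_|_]; first by rewrite rev_cons cat_rcons.
  by case: eqP.
have back x s1 : s1 tmp = x -> exec (While tmp (Case tmp
      (Seq (Pop tmp) (Seq (Push r true) (Push r' true)))
      (Seq (Pop tmp) (Seq (Push r false) (Push r' false))) Skip)) s1
    (upd (upd (upd s1 tmp [::]) r (rev x ++ s1 r)) r' (rev x ++ s1 r')) (5 * size x + 1).
  elim: x s1 => [|b x IH] s1 sr.
    apply: exec_eq (ExecWhileStop _ sr) _ => r1; rewrite !updE.
    by do ![case: eqP => [->|_] //].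
  pose s2 := upd (upd (upd s1 tmp x) r (b :: s1 r)) r' (b :: s1 r').
  have e1 : exec (Case tmp (Seq (Pop tmp) (Seq (Push r true) (Push r' true)))
      (Seq (Pop tmp) (Seq (Push r false) (Push r' false))) Skip) s1 s2 4.
    apply: ExecCase; rewrite sr.
    have e2 : exec (Seq (Pop tmp) (Seq (Push r b) (Push r' b))) s1 s2 (1 + (1 + 1)).
      apply: ExecSeq (ExecPop _ _) (ExecSeq (ExecPush _ _ _) _).
      apply: exec_eq (ExecPush _ _ _) _ => r1.
      by rewrite /s2 !updE /= sr (negbTE rt) [r' == r]eq_sym (negbTE rr') (negbTE r't).
    by case: (b) e2.
  have : s2 tmp = x.
    by rewrite /s2 !updE eqxx [_ == r']eq_sym (negbTE r't) [_ == r]eq_sym (negbTE rt).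
  move/IH => e2; rewrite (_ : 5 * _ + 1 = (4 + (5 * size x + 1)).+1) /=; last by lia.
  apply: ExecWhileStep e1 _; first by rewrite sr.
  apply: exec_eq e2 _ => r1; rewrite /s2 !updE !eqxx (negbTE rr').
  rewrite !rev_cons !cat_rcons.
  by do 3! case: eqP => // _.
have e1 := out _ _ (erefl (s r)); set s1 := upd _ tmp _ in e1.
have s1t : s1 tmp = rev (s r) by rewrite /s1 updE eqxx s0 cats0.
have e2 := back _ _ s1t; rewrite revK size_rev in e2.
have := ExecSeq e1 e2; rewrite (_ : _ + _ = 9 * size (s r) + 2); last by lia.
move=> e; apply: exec_eq e _ => r1; rewrite /s1 !updE !eqxx (negbTE r't) (negbTE rt).
rewrite [r' == r]eq_sym (negbTE rr') cats0; case: eqP => // _; case: eqP => [->//|_].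
by case: eqP => // ->; rewrite s0.
Qed.

(* A store with finitely many nonempty stacks, given as a list so that straight
   line code can be run symbolically. *)
Definition run p l l' t := exists2 t', t' <= t & exec p (nth [::] l) (nth [::] l') t'.

Lemma upd_nth l r x : upd (nth [::] l) r x = nth [::] (set_nth [::] l r x).
Proof. by apply/funext => r'; rewrite nth_set_nth. Qed.

Lemma run_leq p l l' t t' : t <= t' -> run p l l' t -> run p l l' t'.
Proof. by move=> tt' [t1 h1 e]; exists t1 => //; apply: leq_trans tt'. Qed.

Lemma run_skip l : run Skip l l 1.
Proof. by exists 1 => //; apply: ExecSkip. Qed.

Lemma run_push r b l : run (Push r b) l (set_nth [::] l r (b :: nth [::] l r)) 1.
Proof. by exists 1 => //; rewrite -upd_nth; apply: ExecPush. Qed.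

Lemma run_pop r l : run (Pop r) l (set_nth [::] l r (behead (nth [::] l r))) 1.
Proof. by exists 1 => //; rewrite -upd_nth; apply: ExecPop. Qed.

Lemma run_seq p q l l1 l2 t t' : run p l l1 t -> run q l1 l2 t' -> run (Seq p q) l l2 (t + t').
Proof.
move=> [t1 h1 e1] [t2 h2 e2]; exists (t1 + t2); first exact: leq_add.
exact: ExecSeq e1 e2.
Qed.

Lemma run_case r p1 p0 pe l l' t :
  run (match nth [::] l r with true :: _ => p1 | false :: _ => p0 | [::] => pe end) l l' t ->
  run (Case r p1 p0 pe) l l' t.+1.
Proof. by move=> [t1 h1 e1]; exists t1.+1 => //; apply: ExecCase. Qed.

Lemma run_stop r p l : nth [::] l r = [::] -> run (While r p) l l 1.
Proof. by exists 1 => //; apply: ExecWhileStop. Qed.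

Lemma run_step r p l l1 l2 t t' : nth [::] l r <> [::] -> run p l l1 t ->
  run (While r p) l1 l2 t' -> run (While r p) l l2 (t + t').+1.
Proof.
move=> nr [t1 h1 e1] [t2 h2 e2]; exists (t1 + t2).+1; first by rewrite ltnS leq_add.
exact: ExecWhileStep nr e1 e2.
Qed.

Lemma run_copy r r' l : [&& r != r', r != tmp & r' != tmp] -> nth [::] l tmp = [::] ->
  run (copy r r') l (set_nth [::] l r' (nth [::] l r ++ nth [::] l r'))
    (9 * size (nth [::] l r) + 2).
Proof.
case/and3P => a1 a2 a3 l0; exists (9 * size (nth [::] l r) + 2) => //.
by rewrite -upd_nth; apply: exec_copy.
Qed.

Lemma set_set_nth_same l r x y : set_nth [::] (set_nth [::] l r x) r y = set_nth [::] l r y.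
Proof. by rewrite set_set_nth eqxx. Qed.

Lemma run_clear r l : run (While r (Pop r)) l (set_nth [::] l r [::])
  (2 * size (nth [::] l r) + 1).
Proof.
move E: (nth [::] l r) => x; elim: x l E => [|b x IH] l E.
  exists 1 => //; rewrite -upd_nth; apply: exec_eq (ExecWhileStop _ E) _ => r'.
  by rewrite updE; case: eqP => // ->.
have := IH (set_nth [::] l r x); rewrite nth_set_nth /= eqxx => /(_ (erefl _)).
rewrite set_set_nth_same => e; apply: (@run_leq _ _ _ (1 + (2 * size x + 1)).+1); first by lia.
apply: run_step e; first by rewrite E.
by have := run_pop r l; rewrite E.
Qed.

Fixpoint pushes r (x : seq bool) : prog :=
  if x is b :: x' then Seq (pushes r x') (Push r b) else Skip.

Lemma run_pushes r x l : run (pushes r x) l (set_nth [::] l r (x ++ nth [::] l r)) (size x).+1.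
Proof.
elim: x => [|b x IH] /=.
  exists 1 => //; rewrite -upd_nth; apply: exec_eq (ExecSkip _) _ => r'.
  by rewrite updE; case: eqP => // ->.
rewrite -addn1; have := run_push r b (set_nth [::] l r (x ++ nth [::] l r)).
by rewrite set_set_nth_same nth_set_nth /= eqxx => e; exact: run_seq IH e.
Qed.

Definition pops r n : prog := iter n (Seq (Pop r)) Skip.

Lemma run_pops r n l : run (pops r n) l (set_nth [::] l r (drop n (nth [::] l r))) n.+1.
Proof.
elim: n l => [|n IH] l /=.
  exists 1 => //; rewrite -upd_nth; apply: exec_eq (ExecSkip _) _ => r'.
  by rewrite updE drop0; case: eqP => // ->.
have := IH (set_nth [::] l r (behead (nth [::] l r))).
rewrite set_set_nth_same nth_set_nth /= eqxx -[behead _]drop1 drop_drop addn1 drop1 => e.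
by have := run_seq (run_pop r l) e; rewrite add1n.
Qed.

(** Texts with leading continuation bits; [ctext] and [cstext] omit the terminating bit of the list,
    so that they concatenate. *)
Definition ltext (a : literal) : seq bool := true :: encode_literal a.
Definition ctext (c : seq literal) : seq bool := flatten [seq ltext a | a <- c].
Definition clause_text (c : seq literal) : seq bool := true :: ctext c ++ [:: false].
Definition cstext (cs : seq (seq literal)) : seq bool := flatten [seq clause_text c | c <- cs].

Lemma encode_cstext cs : encode cs = cstext cs ++ [:: false].
Proof. by []. Qed.

Lemma ctext_cons a c : ctext (a :: c) = ltext a ++ ctext c.
Proof. by []. Qed.

Lemma ctext_cat c d : ctext (c ++ d) = ctext c ++ ctext d.
Proof. by rewrite /ctext map_cat flatten_cat. Qed.

Lemma cstext_cat c d : cstext (c ++ d) = cstext c ++ cstext d.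
Proof. by rewrite /cstext map_cat flatten_cat. Qed.

Lemma size_ltext a : size (ltext a) = a.1 + 3.
Proof. by rewrite /ltext /encode_literal /= size_cat size_nseq /= addn2 addn3. Qed.

(* Stack 0 is input and output, 1 the next unused variable in unary, 2 the text
   of the padding doping variables, 3 the height of the chains in unary, 4 the
   text of the path through the tower; 5 and 6 are working copies of 3 and 4. *)
Definition lit r b : prog := Seq (Push r b) (Seq (Push r false) (Seq (copy 1 r) (Push r true))).

Lemma run_lit r b v l : (r != 1) && (r != tmp) -> nth [::] l tmp = [::] ->
  nth [::] l 1 = nseq v true ->
  run (lit r b) l (set_nth [::] l r (ltext (v, b) ++ nth [::] l r)) (9 * v + 5).
Proof.
case/andP => r1 rt l0 lv; set x := nth [::] l r.
have e1 := run_push r b l.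
have := run_push r false (set_nth [::] l r (b :: x)).
rewrite set_set_nth_same nth_set_nth /= eqxx => e2.
have := @run_copy 1 r (set_nth [::] l r (false :: b :: x)).
rewrite [1 == r]eq_sym r1 rt => /(_ isT).
rewrite set_set_nth_same !nth_set_nth /= [tmp == r]eq_sym (negbTE rt) => /(_ l0).
rewrite [1 == r]eq_sym (negbTE r1) eqxx lv size_nseq => e3.
have := run_push r true (set_nth [::] l r (nseq v true ++ false :: b :: x)).
rewrite set_set_nth_same nth_set_nth /= eqxx => e4.
have := run_seq e1 (run_seq e2 (run_seq e3 e4)).
rewrite /ltext /encode_literal /= -catA; apply: run_leq; lia.
Qed.

(** Inner nodes and doping variables alternate, so each link uses the next two variables; in all
    there are 2h + 1 variables from [V] on, besides [Q]. *)
Fixpoint chain h V Q : btree nat (seq nat) :=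
  if h is h'.+1 then Node V (Leaf [:: V.+1]) (chain h' V.+2 Q) else Leaf (V :: Q).

(* The doping variables [Q] only pad the number of variables. *)
Fixpoint tower h d b V Q : btree nat (seq nat) :=
  if d is d'.+1 then
    Node b (tower h d' b.+1 V Q) (tower h d' (b + 2 ^ d') (V + 2 ^ d' * (2 * h).+1) [::])
  else chain h V Q.

Lemma cstext1 c : cstext [:: c] = clause_text c.
Proof. by rewrite /cstext /= cats0. Qed.

Lemma run_conv p l l' l'' t t' : run p l l'' t -> l'' = l' -> t <= t' -> run p l l' t'.
Proof. by move=> e <- tt'; apply: run_leq e. Qed.

(** Stacks grow at the front, so a clause is written from its end: terminator, path, node literal,
    doping literal, leading bit. In between, the working path is extended for the next link. *)
Definition chain_body :=
  Seq (Pop 5) (Seq (Push 0 false) (Seq (copy 6 0) (Seq (lit 0 true) (Seq (lit 6 false)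
    (Seq (Push 1 true) (Seq (lit 0 true) (Seq (Push 1 true) (Push 0 true)))))))).

Local Ltac step e := eapply run_seq; [apply: e => //|cbn [set_nth nth]].

Lemma run_chain_body o V Q H X G R :
  run chain_body [:: o; nseq V true; Q; H; X; true :: G; ctext R; [::]]
    [:: clause_text [:: (V.+1, true), (V, true) & R] ++ o; nseq V.+2 true; Q; H; X; G;
        ctext ((V, false) :: R); [::]] (9 * size (ctext R) + 27 * V + 40).
Proof.
eapply run_conv.
  rewrite /chain_body.
  step run_pop. step run_push. step run_copy.
  eapply run_seq; [apply: (@run_lit _ _ V) => //|cbn [set_nth nth]].
  eapply run_seq; [apply: (@run_lit _ _ V) => //|cbn [set_nth nth]].
  step run_push.
  eapply run_seq; [apply: (@run_lit _ _ V.+1) => //|cbn [set_nth nth]].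
  step run_push.
  by apply: run_push.
- cbn [set_nth nth behead]; rewrite /clause_text !ctext_cons -!catA /=.
  by congr [:: _, _, _, _, _, _, _ & _]; rewrite -!catA /= -?catA /= -?catA.
- cbn [set_nth nth behead]; lia.
Qed.

(** [W] bounds the variables and [L] the path texts, which makes the time bound uniform. The last
    clause, with the padding, is left to [chain_prog], so the output is described by what prepending
    that clause yields. *)
Lemma run_chain_loop h V Q0 Q H X R o W L :
  V + 2 * h < W -> size (ctext R) + h * (W + 3) <= L ->
  exists o' R', run (While 5 chain_body)
      [:: o; nseq V true; Q; H; X; nseq h true; ctext R; [::]]
      [:: o'; nseq (V + 2 * h) true; Q; H; X; [::]; ctext R'; [::]]
      (h * (9 * L + 27 * W + 41) + 1) /\
    clause_text ((V + 2 * h, true) :: pos Q0 ++ R') ++ o' =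
      cstext (gen (chain h V Q0) R) ++ o /\ size (ctext R') <= L.
Proof.
elim: h V R o => [|h IH] V R o VW RL.
  exists o, R; rewrite muln0 addn0; split; first exact: run_stop.
  by rewrite /cstext /= cats0; split=> //; lia.
have [||o' [R' [e [eo' sR']]]] := IH V.+2 ((V, false) :: R)
  (clause_text [:: (V.+1, true), (V, true) & R] ++ o).
- by lia.
- by rewrite ctext_cons size_cat size_ltext /=; lia.
exists o', R'; split; last first.
  rewrite (_ : V + 2 * h.+1 = V.+2 + 2 * h); last by lia.
  by rewrite eo' [gen _ _]/= cstext_cat cstext1 -!catA.
rewrite (_ : V + 2 * h.+1 = V.+2 + 2 * h); last by lia.
apply: run_leq (run_step _ (run_chain_body _ _ _ _ _ _ _) e) => //.
have VW' : V < W by lia.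
have RL' : size (ctext R) <= L by apply: leq_trans RL; apply: leq_addr.
by rewrite mulSn; lia.
Qed.

Definition chain_prog :=
  Seq (copy 3 5) (Seq (copy 4 6) (Seq (While 5 chain_body)
    (Seq (Push 0 false) (Seq (copy 6 0) (Seq (copy 2 0) (Seq (While 2 (Pop 2))
      (Seq (lit 0 true) (Seq (Push 1 true) (Seq (Push 0 true) (While 6 (Pop 6))))))))))).

Definition chain_time h W L := 9 * h + (h * (9 * L + 27 * W + 41)) + 31 * L + 9 * W + 30.

Lemma run_chain_prog h V Q0 P o W L :
  V + 2 * h < W -> size (ctext P) + h * (W + 3) <= L -> size (ctext (pos Q0)) <= L ->
  run chain_prog [:: o; nseq V true; ctext (pos Q0); nseq h true; ctext P; [::]; [::]; [::]]
    [:: cstext (gen (chain h V Q0) P) ++ o; nseq (V + (2 * h).+1) true; [::]; nseq h true;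
        ctext P; [::]; [::]; [::]] (chain_time h W L).
Proof.
move=> VW PL QL.
have [u [R' [e [eo sR']]]] := run_chain_loop Q0 (ctext (pos Q0)) (nseq h true) (ctext P) o VW PL.
eapply run_conv.
  rewrite /chain_prog.
  step run_copy. step run_copy. rewrite !cats0.
  eapply run_seq; [apply: e|].
  step run_push. step run_copy. step run_copy. step run_clear.
  eapply run_seq; [apply: (@run_lit _ _ (V + 2 * h)) => //|cbn [set_nth nth]].
  step run_push. step run_push. by apply: run_clear.
- cbn [set_nth nth]; rewrite -eo addnS; congr [:: _, _, _, _, _, _, _ & _].
  by rewrite /clause_text ctext_cons ctext_cat cat_cons -!catA.
- cbn [set_nth nth]; rewrite size_nseq /chain_time.
  have PL' : size (ctext P) <= L by apply: leq_trans PL; apply: leq_addr.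
  by lia.
Qed.

(** The depth is a constant, so the recursion is unrolled into the program text, with the node
    variables as fixed bit strings; [b + 3] is the length of the text of a literal on [b]. *)
Fixpoint tower_prog d b :=
  if d is d'.+1 then
    Seq (pushes 4 (ltext (b, true))) (Seq (tower_prog d' b.+1)
      (Seq (pops 4 (b + 3)) (Seq (pushes 4 (ltext (b, false)))
        (Seq (tower_prog d' (b + 2 ^ d')) (pops 4 (b + 3))))))
  else chain_prog.

(** The subtree treated last ends up in front, as in [gen]. The subtracted term of the time bound
    absorbs the work at inner nodes: two copies of it are saved, one is spent. *)
Lemma run_tower_prog h d b V Q0 P o W L :
  V + 2 ^ d * (2 * h).+1 <= W -> b + 2 ^ d <= W.+1 ->
  size (ctext P) + (d + h) * (W + 3) <= L -> size (ctext (pos Q0)) <= L ->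
  run (tower_prog d b)
    [:: o; nseq V true; ctext (pos Q0); nseq h true; ctext P; [::]; [::]; [::]]
    [:: cstext (gen (tower h d b V Q0) P) ++ o; nseq (V + 2 ^ d * (2 * h).+1) true; [::];
        nseq h true; ctext P; [::]; [::]; [::]]
    (2 ^ d * (chain_time h W L + 4 * W + 16) - (4 * W + 16)).
Proof.
elim: d b V Q0 P o => [|d IH] b V Q0 P o VW bW PL QL.
  rewrite expn0 mul1n in VW; rewrite expn0 !mul1n -[_ + _ + 16]addnA addnK.
  by apply: run_chain_prog => //; lia.
rewrite expnS in VW bW *.
have d0 : 0 < 2 ^ d by rewrite expn_gt0.
have sz c : size (ctext ((b, c) :: P)) + (d + h) * (W + 3) <= L.
  by rewrite ctext_cons size_cat size_ltext /=; lia.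
have e1 := IH b.+1 V Q0 ((b, true) :: P) o _ _ (sz true) QL.
have e2 := IH (b + 2 ^ d) (V + 2 ^ d * (2 * h).+1) [::] ((b, false) :: P)
  (cstext (gen (tower h d b.+1 V Q0) ((b, true) :: P)) ++ o) _ _ (sz false) (leq0n _).
have drop_ltext c : drop (b + 3) (ctext ((b, c) :: P)) = ctext P.
  by rewrite ctext_cons drop_size_cat // size_ltext.
eapply run_conv.
  cbn [tower_prog].
  step run_pushes. rewrite -ctext_cons.
  eapply run_seq; [apply: e1; nia|].
  step run_pops. rewrite drop_ltext.
  step run_pushes. rewrite -ctext_cons.
  eapply run_seq; [apply: e2; nia|].
  by apply: run_pops.
- cbn [set_nth nth]; rewrite drop_ltext /= cstext_cat catA.
  congr [:: _, _, _, _, _, _, _ & _]; congr nseq; lia.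
- rewrite !size_ltext /=; set X := 2 ^ d * _.
  have : 4 * W + 16 <= X by rewrite /X; nia.
  by rewrite -mulnA -/X; lia.
Qed.

(** * Unary division and the main program *)

Definition padn i : prog := iter i (Seq (Seq (lit 2 true) (Push 1 true))) Skip.

Lemma run_padn i N V Q H X Y Z :
  run (padn i) [:: N; nseq V true; ctext (pos Q); H; X; Y; Z; [::]]
    [:: N; nseq (V + i) true; ctext (pos (rev (iota V i) ++ Q)); H; X; Y; Z; [::]]
    (i * (9 * (V + i) + 10) + 1).
Proof.
elim: i V Q => [|i IH] V Q; first by rewrite addn0; apply: run_skip.
eapply run_conv.
  rewrite /padn iterS.
  eapply run_seq.
    eapply run_seq; [apply: (@run_lit _ _ V) => //|cbn [set_nth nth]].
    by apply: run_push.
  cbn [set_nth nth]; rewrite -[true :: nseq V true]/(nseq V.+1 true).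
  rewrite -[ltext _ ++ _]/(ctext (pos (V :: Q))).
  exact: IH.
- by rewrite addSnnS /= rev_cons cat_rcons.
- by rewrite mulSn; nia.
Qed.

(* Take [m] units from stack 0 and go on with [yes]; if there are less, turn
   those taken, and the [i] taken before, into doping variables. *)
Fixpoint grab i m yes no : prog :=
  if m is m'.+1 then
    Case 0 (Seq (Pop 0) (grab i.+1 m' yes no)) Skip (Seq (padn i) no)
  else yes.

Lemma run_grab_yes i m a yes no l l' t :
  run yes (nseq a true :: l) l' t ->
  run (grab i m yes no) (nseq (m + a) true :: l) l' (2 * m + t).
Proof.
move=> e; elim: m i => [//|m IH] i /=.
apply: (@run_leq _ _ _ (1 + (2 * m + t)).+1); first by lia.
apply: run_case => /=; exact: (run_seq (run_pop 0 (nseq (m.+1 + a) true :: l)) (IH i.+1)).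
Qed.

Lemma run_grab_no i m a yes no l l' t : a < m ->
  run (Seq (padn (i + a)) no) ([::] :: l) l' t ->
  run (grab i m yes no) (nseq a true :: l) l' (2 * a + 1 + t).
Proof.
elim: m i a => [//|m IH] i [|a] am /=.
  by rewrite addn0 => e; rewrite add0n add1n; apply: run_case.
rewrite -addSnnS => e.
apply: (@run_leq _ _ _ (1 + (2 * a + 1 + t)).+1); first by lia.
apply: run_case => /=; exact: (run_seq (run_pop 0 (nseq a.+1 true :: l)) (IH _ _ am e)).
Qed.

(** Division by repeated subtraction: the quotient is collected on stack 3, and the remainder
    becomes doping variables. *)
Definition divide K := While 0 (grab 0 K (Push 3 true) Skip).

Definition divide_time K V a := a * (2 * K + 2) + K * (9 * (V + K) + 10) + 2 * K + 5.

Lemma run_divide K V a r h X Y Z : r < K ->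
  run (divide K) [:: nseq (K * a + r) true; nseq V true; [::]; nseq h true; X; Y; Z; [::]]
    [:: [::]; nseq (V + r) true; ctext (pos (rev (iota V r))); nseq (h + a) true; X; Y; Z; [::]]
    (divide_time K V a).
Proof.
move=> rK; elim: a h => [|a IH] h.
  rewrite muln0 add0n addn0; case: r rK => [|r] rK.
    by rewrite addn0; apply: (@run_leq _ _ _ 1); [rewrite /divide_time; lia|exact: run_stop].
  have := run_padn (0 + r.+1) [::] V [::] (nseq h true) X Y Z; rewrite cats0 add0n => e.
  have {}e := run_grab_no (i := 0) (Push 3 true) rK (run_seq e (run_skip _)).
  apply: run_leq (run_step _ e (run_stop _ _)) => //.
  have : r.+1 * (9 * (V + r.+1) + 10) <= K * (9 * (V + K) + 10).
    by apply: leq_mul; lia.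
  by rewrite /divide_time; lia.
rewrite mulnS -addnA -addSnnS.
have e := @run_push 3 true
  [:: nseq (K * a + r) true; nseq V true; [::]; nseq h true; X; Y; Z; [::]].
have {}e := run_grab_yes 0 K Skip e.
have nz : nth [::] (nseq (K + (K * a + r)) true ::
    [:: nseq V true; [::]; nseq h true; X; Y; Z; [::]]) 0 <> [::] by case: K rK {IH e}.
apply: run_leq (run_step nz e (IH h.+1)).
by rewrite /divide_time mulSn; lia.
Qed.

Definition small_prog :=
  Seq (Push 0 false) (Seq (Push 0 false) (Seq (copy 2 0) (Push 0 true))).

Definition big_prog k := Seq (divide (2 * 2 ^ k)) (Seq (Push 0 false) (tower_prog k 0)).

Definition main_prog k :=
  Seq (pushes 1 (nseq (2 ^ k).-1 true))
      (grab 0 (2 * 2 ^ k).-1 (big_prog k) small_prog).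

(** A tower over [m] chains of height [a] uses (m - 1) + m(2a + 1) = (2m - 1) + 2ma variables, and
    padding supplies the remainder [r]. Below 2m - 1 a single clause is used; its variables start at
    m - 1 because the program sets its counter before it inspects [n]. *)
Definition treeG k n : btree nat (seq nat) :=
  let m := 2 ^ k in
  if n < (2 * m).-1 then Leaf (rev (iota m.-1 n))
  else let a := (n - (2 * m).-1) %/ (2 * m) in let r := (n - (2 * m).-1) %% (2 * m) in
       tower a k 0 (m.-1 + r) (rev (iota m.-1 r)).

Lemma treeG_large k a r : r < 2 * 2 ^ k ->
  treeG k ((2 * 2 ^ k).-1 + (2 * 2 ^ k * a + r)) =
  tower a k 0 ((2 ^ k).-1 + r) (rev (iota (2 ^ k).-1 r)).
Proof.
move=> rm; rewrite /treeG ltnNge leq_addr /= addKn mulnC divnMDl ?modnMDl; last by lia.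
by rewrite divn_small // modn_small // addn0.
Qed.

Variant treeG_spec k n : btree nat (seq nat) -> Prop :=
| TreeGSmall of n < (2 * 2 ^ k).-1 : treeG_spec k n (Leaf (rev (iota (2 ^ k).-1 n)))
| TreeGLarge a r of r < 2 * 2 ^ k & n = (2 * 2 ^ k).-1 + (2 * 2 ^ k * a + r) :
    treeG_spec k n (tower a k 0 ((2 ^ k).-1 + r) (rev (iota (2 ^ k).-1 r))).

Lemma treeGP k n : treeG_spec k n (treeG k n).
Proof.
rewrite /treeG; case: ltnP => nm; first by constructor.
have m0 : 0 < 2 * 2 ^ k by rewrite muln_gt0 expn_gt0.
constructor; first by rewrite ltn_mod.
by rewrite [2 * 2 ^ k * _]mulnC -divn_eq subnKC.
Qed.

Lemma size_ctext_pos Q B : all (leq^~ B) Q -> size (ctext (pos Q)) <= size Q * (B + 3).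
Proof.
elim: Q => [//|x Q IH] /andP[xB /IH].
rewrite -[pos (x :: Q)]/((x, true) :: pos Q) ctext_cons
   size_cat size_ltext [size (_ :: _)]/= mulSn.
by rewrite [(x, true).1]/=; lia.
Qed.

Definition main_time k n :=
  (2 ^ k).+1 + (4 * 2 ^ k + divide_time (2 * 2 ^ k) (2 ^ k) n +
    2 ^ k * (chain_time n n ((k + n) * (n + 3)) + 4 * n + 16) + 10
  + 2 * n + n * (9 * (2 ^ k + n) + 10) + 9 * (n * (2 ^ k + n + 3))).

Lemma run_main_prog k n : exists2 l,
  run (main_prog k) [:: nseq n true; [::]; [::]; [::]; [::]; [::]; [::]; [::]] l (main_time k n)
  & nth [::] l 0 = encode (gen (treeG k n) [::]).
Proof.
have m0 : 0 < 2 ^ k by rewrite expn_gt0.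
set m := 2 ^ k in m0 *.
have e1 := run_pushes 1 (nseq m.-1 true)
  [:: nseq n true; [::]; [::]; [::]; [::]; [::]; [::]; [::]].
cbn [set_nth nth] in e1; rewrite cats0 size_nseq prednK // in e1.
have Qs i : size (ctext (pos (rev (iota m.-1 i)))) <= i * (m + i + 3).
  have := @size_ctext_pos (rev (iota m.-1 i)) (m + i); rewrite size_rev size_iota; apply.
  by rewrite all_rev; apply/allP => x; rewrite mem_iota => /andP[_]; lia.
case: treeGP => [nm|a r rm nE].
  have e2 := run_padn (0 + n) [::] m.-1 [::] [::] [::] [::] [::]; rewrite cats0 add0n in e2.
  eexists.
    apply: run_leq; last first.
      apply: run_seq e1 _; apply: run_grab_no nm _.
      apply: run_seq e2 _; rewrite /small_prog.
      step run_push. step run_push. step run_copy. by apply: run_push.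
    by cbn [set_nth nth]; have := Qs n; rewrite /main_time -/m; nia.
  by cbn [set_nth nth]; rewrite encode_cstext [gen _ _]/= cats0 cstext1 /clause_text cat_cons -catA.
have e2 := run_divide m.-1 a 0 [::] [::] [::] rm; rewrite add0n in e2.
have an : a <= n by rewrite nE; nia.
have rn : r <= n by rewrite nE; lia.
(* The counter ends at [n], so [n] can serve as the bound [W] on variables. *)
have WE : m.-1 + r + m * (2 * a).+1 = n by rewrite nE -/m mulnS; move: m0; clear; nia.
have VW : m.-1 + r + 2 ^ k * (2 * a).+1 <= n by rewrite -/m WE.
have bW : 0 + 2 ^ k <= n.+1 by rewrite -/m; lia.
have PL : size (ctext [::]) + (k + a) * (n + 3) <= (k + n) * (n + 3).
  by rewrite leq_mul // leq_add2l.
have QL : size (ctext (pos (rev (iota m.-1 r)))) <= (k + n) * (n + 3).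
  apply: leq_trans (Qs r) _; apply: leq_mul; first by rewrite (leq_trans rn) // leq_addl.
  by lia.
have e3 := run_tower_prog [:: false] VW bW PL QL.
have e4 := run_push 0 false [:: [::]; nseq (m.-1 + r) true; ctext (pos (rev (iota m.-1 r)));
  nseq a true; [::]; [::]; [::]; [::]].
have e5 := run_grab_yes 0 (2 * 2 ^ k).-1 small_prog (run_seq e2 (run_seq e4 e3)).
rewrite -nE in e5; eexists.
  apply: run_leq (run_seq e1 e5).
  have : divide_time (2 * m) m.-1 a <= divide_time (2 * m) m n.
    rewrite /divide_time !leq_add2r; apply: leq_add; apply: leq_mul => //.
    by rewrite leq_add2r leq_mul2l leq_add2r leq_pred orbT.
  have : chain_time a n ((k + n) * (n + 3)) <= chain_time n n ((k + n) * (n + 3)).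
    rewrite /chain_time !leq_add2r; apply: leq_add; last exact: leq_mul.
    exact: leq_mul.
  rewrite /main_time -/m; set X1 := chain_time a _ _; set X2 := chain_time n _ _ => X12.
  have : m * (X1 + 4 * n + 16) <= m * (X2 + 4 * n + 16).
    by apply: leq_mul => //; apply: leq_add => //; apply: leq_add => //; exact: X12.
  set D1 := divide_time _ _ _; set D2 := divide_time _ _ _.
  set E1 := m * (X1 + _ + _); set E2 := m * (X2 + _ + _).
  by move: m0; clear; lia.
by cbn [set_nth nth]; rewrite encode_cstext.
Qed.

(** * Polynomially bounded functions *)

Lemma poly_bounded_const c : poly_bounded (fun=> c).
Proof. by exists 1, c => n; rewrite expn1. Qed.

Lemma poly_bounded_id : poly_bounded id.
Proof. by exists 1, 0 => n _; rewrite expn1. Qed.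

Lemma poly_bounded_add f g : poly_bounded f -> poly_bounded g ->
  poly_bounded (fun n => f n + g n).
Proof.
(* The additional factor [n >= 2] absorbs the doubling caused by the sum. *)
move=> [e1 [N1 h1]] [e2 [N2 h2]]; exists (e1 + e2).+1, (N1 + N2 + 2) => n Nn.
have {}h1 : f n <= n ^ (e1 + e2).
  by apply: leq_trans (h1 _ _) _; rewrite ?leq_pexp2l //; lia.
have {}h2 : g n <= n ^ (e1 + e2).
  by apply: leq_trans (h2 _ _) _; rewrite ?leq_pexp2l //; lia.
by rewrite expnS; apply: leq_trans (leq_add h1 h2) _;
  rewrite addnn -mul2n leq_mul2r; apply/orP; right; lia.
Qed.

Lemma poly_bounded_mul f g : poly_bounded f -> poly_bounded g ->
  poly_bounded (fun n => f n * g n).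
Proof.
move=> [e1 [N1 h1]] [e2 [N2 h2]]; exists (e1 + e2), (N1 + N2) => n Nn.
by rewrite expnD leq_mul ?h1 ?h2 //; lia.
Qed.

Lemma poly_bounded_main_time k : poly_bounded (main_time k).
Proof.
by rewrite /main_time /divide_time /chain_time;
  repeat first [apply: poly_bounded_const|apply: poly_bounded_id|
    apply: poly_bounded_add|apply: poly_bounded_mul].
Qed.

Lemma treeG_computable k : poly_time_computable (fun n => doped (treeG k n)).
Proof.
exists (main_prog k), (main_time k); split; first exact: poly_bounded_main_time.
move=> n _; have [l [t tle e] l0] := run_main_prog k n.
exists (nth [::] l), t, (gen (treeG k n) [::]); split=> //.
suff E : nth [::] [:: nseq n true; [::]; [::]; [::]; [::]; [::]; [::]; [::]] =
         [eta fun=> [::] with 0 |-> nseq n true] :> store by rewrite -E.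
by apply/funext => -[|[|[|[|[|[|[|[|r]]]]]]]] //=; rewrite nth_nil.
Qed.

End Programs.

(** * The separation *)

Section Separation.
Local Open Scope fset_scope.
Local Open Scope nat_scope.

Lemma allvars_chain h V Q : allvars (chain h V Q) = iota V (2 * h).+1 ++ Q.
Proof.
elim: h V => [//|h IH] V; rewrite (_ : (2 * h.+1).+1 = (2 * h).+3); last by lia.
by rewrite /= IH.
Qed.

Lemma allvars_tower h d b V Q : perm_eq (allvars (tower h d b V Q))
  (iota b (2 ^ d).-1 ++ iota V (2 ^ d * (2 * h).+1) ++ Q).
Proof.
elim: d b V Q => [|d IH] b V Q; first by rewrite expn0 mul1n /= allvars_chain.
have -> : 2 ^ d.+1 * (2 * h).+1 = 2 ^ d * (2 * h).+1 + 2 ^ d * (2 * h).+1.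
  by rewrite expnS -mulnA mul2n -addnn.
have -> : (2 ^ d.+1).-1 = ((2 ^ d).-1 + (2 ^ d).-1).+1.
  by have : 0 < 2 ^ d by [rewrite expn_gt0]; rewrite expnS; lia.
rewrite [allvars _]/=; set M := 2 ^ d * _; rewrite [iota b _]/= !iotaD perm_cons.
have -> : b.+1 + (2 ^ d).-1 = b + 2 ^ d by rewrite addSnnS prednK ?expn_gt0.
apply: perm_trans (perm_cat (IH _ _ _) (IH _ _ _)) _.
by apply/permP => x; rewrite -/M !count_cat [count _ [::]]/=; lia.
Qed.

Lemma good_tower h d b V Q : uniq (allvars (tower h d b V Q)) -> good (tower h d b V Q).
Proof.
move=> uT; rewrite /good uT /= {uT}.
elim: d b V Q => [|d IH] b V Q /=; last by rewrite !IH.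
by elim: h V => //= h IH V; rewrite IH.
Qed.

(** Each of the [d] levels uses up one unit of the budget, and the chains at the bottom have height
    [h]. *)
Lemma needs_tower h d b V Q : good (tower h d b V Q) -> needs d (tower h d b V Q) (2 ^ h).
Proof.
elim: d b V Q => [|d IH] b V Q gT /=.
  have := needs0_height gT; rewrite [tower _ _ _ _ _]/=.
  suff -> : height (chain h V Q) = h by [].
  by elim: h V {gT} => //= h IH V; rewrite IH max0n.
have [g1 g2 _ _ _] := good_node gT.
by apply: needs_node => //; apply: IH.
Qed.

Lemma hts_tower h d b V Q : hts (tower h d b V Q) <= d.+1.
Proof.
elim: d b V Q => [|d IH] b V Q /=.
  by elim: h V => //= h IH V; move: (IH V.+2); case: eqP; lia.
by move: (IH b.+1 V Q) (IH (b + 2 ^ d) (V + 2 ^ d * (2 * h).+1) [::]); case: eqP; lia.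
Qed.

Lemma allvars_treeG k n : perm_eq (allvars (treeG k n))
  (iota (if n < (2 * 2 ^ k).-1 then (2 ^ k).-1 else 0) n).
Proof.
have m0 : 0 < 2 ^ k by rewrite expn_gt0.
case: treeGP => [nm|a r rm nE]; first by rewrite nm perm_rev.
have -> : n < (2 * 2 ^ k).-1 = false by rewrite nE; lia.
apply: perm_trans (allvars_tower _ _ _ _ _) _.
have -> : n = (2 ^ k).-1 + (r + 2 ^ k * (2 * a).+1) by rewrite nE mulnS; nia.
by rewrite !iotaD !add0n perm_cat2l perm_catC perm_cat2r perm_rev.
Qed.

Lemma treeG_good k n : 0 < n ->
  [/\ good (treeG k n), nvars (doped (treeG k n)) = n & hts (treeG k n) <= k.+1].
Proof.
move=> n0; have pT := allvars_treeG k n.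
have uT : uniq (allvars (treeG k n)) by rewrite (perm_uniq pT) iota_uniq.
rewrite nvars_doped // (perm_size pT) size_iota.
case: treeGP uT => [nm|a r rm nE] uT; split=> //.
- by rewrite /good uT /= -size_eq0 size_rev size_iota -lt0n.
- exact: good_tower.
- exact: hts_tower.
Qed.

(** Satisfiability excludes the empty clause, so every clause contributes a literal. *)
Lemma nclauses_le_nlits F : satisfiable F -> nclauses F <= nlits F.
Proof.
case=> phi /papply_eq0 sF; rewrite /nclauses /nlits -sum1_size big_seq [leqRHS]big_seq.
apply: leq_sum => C /sF /hasP[l lC _]; rewrite cardfs_gt0.
by apply: contraTneq lC => ->; rewrite in_fset0.
Qed.

Lemma exp_gt_poly c e N : exists2 h, N <= h & (c * h.+1) ^ e < 2 ^ h.
Proof.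
(* The witness h = 2^(2i) - 1 makes h + 1 a power of two, so only exponents are compared: (c + 2i)e
   + 1 < (i + 1)^2 <= h + 1. *)
set i := (c + 2) * e.+1 + N.
have big i' : i'.+1 <= 2 ^ i' by exact: ltn_expl.
have sq : i.+1 * i.+1 <= 2 ^ (2 * i) by rewrite mul2n -addnn expnD leq_mul.
exists (2 ^ (2 * i)).-1; first by move: sq; rewrite /i; nia.
rewrite prednK ?expn_gt0 //.
apply: (@leq_ltn_trans (2 ^ ((c + 2 * i) * e))).
  case: (posnP e) => [->|e0]; first by rewrite muln0.
  rewrite [2 ^ ((c + _) * e)]expnM leq_exp2r // expnD leq_mul2r; apply/orP; right.
  by apply: ltnW; apply: ltn_expl.
rewrite ltn_exp2l //.
suff : ((c + 2 * i) * e).+1 < i.+1 * i.+1 by move: sq; lia.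
have : (c + 2) * e.+1 <= i by rewrite leq_addr.
by nia.
Qed.

Lemma treeG_separation k : exists G : nat -> clause_set,
  [/\ forall n : nat, (0 < n)%N ->
        [/\ is_clause_set (G n), nvars (G n) = n & UC k.+1 (G n)],
      poly_time_computable G
    & ~ exists G' : nat -> clause_set,
        (forall n : nat, (0 < n)%N ->
           [/\ is_clause_set (G' n), equivalent (G' n) (G n)
             & WC k (G' n)]) /\
        poly_bounded (fun n => nlits (G' n))].
Proof.
exists (fun n => doped (treeG k n)); split.
- move=> n /(treeG_good k)[gT nT hT]; split=> //; first exact: doped_clause_set.
  exact: doped_UC.
- exact: treeG_computable.
case=> G' [G'P [e [N G'N]]].
have m0 : 0 < 2 ^ k by rewrite expn_gt0.
have [h Nh hbig] := exp_gt_poly (2 * 2 ^ k) e N.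
(* Remainder 0 and quotient [h]: the chains have height [h], while [n] is only linear in [h]. *)
pose n := (2 * 2 ^ k).-1 + (2 * 2 ^ k * h + 0).
have n0 : 0 < n by rewrite /n; lia.
have nh : n <= 2 * 2 ^ k * h.+1 by rewrite /n mulnS; lia.
have [cG eG wG] := G'P n n0; have [gT _ _] := treeG_good k n0.
have sG : satisfiable (G' n).
  by apply: equivalent_satisfiable eG (doped_satisfiable _); case/andP: gT.
have nT : needs k (treeG k n) (2 ^ h).
  rewrite treeG_large; last by rewrite muln_gt0.
  by apply: needs_tower; rewrite -treeG_large // muln_gt0.
have lb := equivalent_lower_bound gT nT cG eG wG.
have ub : nlits (G' n) <= n ^ e by apply: G'N; rewrite /n; nia.
have : 2 ^ h <= (2 * 2 ^ k * h.+1) ^ e.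
  apply: leq_trans lb (leq_trans (nclauses_le_nlits sG) (leq_trans ub _)).
  by case: (posnP e) => [->//|e0]; rewrite leq_exp2r.
by rewrite leqNgt hbig.
Qed.

End Separation.

Local Open Scope classical_set_scope.
Local Open Scope ring_scope.

Theorem theorem6p14 (R : realType) (k : nat) :
  (forall (T : nat -> btree nat unit) (u : nat -> clause -> nat),
    (forall h : nat, (k.+1 <= h)%N ->
       [/\ extremal k.+1 h (T h), uniq (inner_labels (T h))
         & doping_vars (F1 (T h)) (u h)]) ->
    let F h := doping (F1 (T h)) (u h) in
    [/\ (fun h => (nvars (F h))%:R : R) =Theta_\oo (fun h => h%:R ^+ k.+1),
        (fun h => (nclauses (F h))%:R : R) =Theta_\oo (fun h => h%:R ^+ k.+1),
        forall h : nat, (k.+1 <= h)%N -> UC k.+1 (F h)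
      & forall F' : nat -> clause_set,
          (forall h : nat, (k.+1 <= h)%N ->
             [/\ is_clause_set (F' h), equivalent (F' h) (F h)
               & WC k (F' h)]) ->
          (fun h => (nclauses (F' h))%:R : R)
            =Omega_\oo (fun h => 2 ^+ h / Num.sqrt h%:R)]) /\
  exists G : nat -> clause_set,
    [/\ forall n : nat, (0 < n)%N ->
          [/\ is_clause_set (G n), nvars (G n) = n & UC k.+1 (G n)],
        poly_time_computable G
      & ~ exists G' : nat -> clause_set,
          (forall n : nat, (0 < n)%N ->
             [/\ is_clause_set (G' n), equivalent (G' n) (G n)
               & WC k (G' n)]) /\
          poly_bounded (fun n => nlits (G' n))].
Proof.
split; last exact: treeG_separation.
by move=> T u; exact: extremal_doping.
Qed.
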